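(* Let $T$ be a tiling of $\mathbb{R}^d$ with tiling space $\Omega_T$, and let $\{d_r\}_{r>0}$ be the family on $\Omega_T$ defined by $d_r(T_1,T_2)=\inf\{\varepsilon>0\mid\exists u\in\mathbb{R}^d,\ |u|<\varepsilon,\ (T_1+u)\cap rD=T_2\cap rD\}$ (with value $\infty$ if no such $u$ exists). Then the diffeology on $\Omega_T$ generated by the family of maps $\{F_{T_1}\colon\mathbb{R}^d\to\Omega_T,\ x\mapsto T_1+x\mid T_1\in\Omega_T\}$ coincides with the diffeology induced by $\{d_r\}_{r>0}$, namely the set of parametrizations $p\colon U_p\to\Omega_T$ such that for every $t_0\in U_p$ there exists $\delta>0$ with: (1) for each $r>0$, $t\mapsto d_r(p(t_0),p(t))$ is continuous on $B_\delta(t_0)$; (2) for each $t_1\in B_\delta(t_0)\setminus p^{-1}(p(t_0))$ and each $r>0$, $t\mapsto d_r(p(t_1),p(t))$ is smooth at $t_0$ (as a real-valued map on $B_\delta(t_0)$).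
   Context: A tiling of $\mathbb{R}^d$ ($d\ge1$) is a collection $T$ of subsets of $\mathbb{R}^d$ (tiles) such that: each tile is a translate of one of finitely many subsets $\tau_1,\dots,\tau_n$ (the prototiles); each tile is homeomorphic to a closed $d$-disk; the union of the tiles is $\mathbb{R}^d$; distinct tiles have disjoint interiors. For $A\subset\mathbb{R}^d$, $T\cap A=\{t\in T\mid t\cap A\ne\emptyset\}$; $T+x=\{t+x\mid t\in T\}$; $rD$ is the closed ball of radius $r$ about $0$ and $B_\rho(c)$ the open ball of radius $\rho$ about $c$. On the orbit $\{T+x\mid x\in\mathbb{R}^d\}$ the metric $d(T,T')$ is the infimum of the set of $\varepsilon>0$ for which there exist $u,v$ with $|u|,|v|<\varepsilon$ and $(T+u)\cap B_{1/\varepsilon}(0)=(T'+v)\cap B_{1/\varepsilon}(0)$, together with $1/\sqrt2$; $\Omega_T$ is the metric completion, each element regarded as a tiling whose tiles are translates of prototiles of $T$. A parametrization is a map from an open subset $U_p$ of some $\mathbb{R}^n$. A diffeology on a set $X$ is a set of parametrizations containing all constant ones, closed under locality (a parametrization whose restrictions to the members of some open cover of its domain are in the set is in the set) and under precomposition with smooth maps between open subsets of Euclidean spaces. The diffeology generated by a family $\mathscr F$ of parametrizations is the smallest diffeology containing $\mathscr F$. *)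

(* Defs.v *)
From HB Require Import structures.
From mathcomp Require Import all_boot all_order all_algebra.
From mathcomp Require Import all_classical all_reals all_analysis.
Set Implicit Arguments. Unset Strict Implicit. Unset Printing Implicit Defensive.
Import Order.TTheory GRing.Theory Num.Theory.
Import numFieldNormedType.Exports.
Local Open Scope classical_set_scope.
Local Open Scope ring_scope.

Section TilingDefs.
Variable R : realType.

Definition enorm (n : nat) (x : 'rV[R]_n) : R :=
  Num.sqrt (\sum_(i < n) x ord0 i ^+ 2).

Definition eball (n : nat) (c : 'rV[R]_n) (rho : R) : set 'rV[R]_n :=
  [set y | enorm (y - c) < rho].
Definition cball (n : nat) (r : R) : set 'rV[R]_n :=
  [set y | enorm y <= r].
Arguments cball n r : clear implicits.

Definition tr_set (d : nat) (t : set 'rV[R]_d) (x : 'rV[R]_d) : set 'rV[R]_d :=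
  [set y + x | y in t].
Definition tr_tiling (d : nat) (T : set (set 'rV[R]_d)) (x : 'rV[R]_d)
  : set (set 'rV[R]_d) := [set tr_set t x | t in T].

Definition patch (d : nat) (T : set (set 'rV[R]_d)) (A : set 'rV[R]_d)
  : set (set 'rV[R]_d) := [set t | T t /\ exists y, t y /\ A y].

Definition homeomorphic (d : nat) (A B : set 'rV[R]_d) : Prop :=
  exists (f g : 'rV[R]_d -> 'rV[R]_d),
    (forall x, A x -> B (f x)) /\ (forall y, B y -> A (g y)) /\
    (forall x, A x -> g (f x) = x) /\ (forall y, B y -> f (g y) = y) /\
    {within A, continuous f} /\ {within B, continuous g}.

Definition is_tiling (d : nat) (T : set (set 'rV[R]_d)) : Prop :=
  (exists (n : nat) (tau : 'I_n -> set 'rV[R]_d),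
      forall t, T t -> exists (i : 'I_n) (x : 'rV[R]_d), t = tr_set (tau i) x) /\
  (forall t, T t -> homeomorphic t (cball d 1)) /\
  (forall y : 'rV[R]_d, exists t, T t /\ t y) /\
  (forall t t', T t -> T t' -> t <> t' -> interior t `&` interior t' = set0).

Definition tdist (d : nat) (T1 T2 : set (set 'rV[R]_d)) : R :=
  inf ([set e : R | 0 < e /\ exists u v : 'rV[R]_d,
          enorm u < e /\ enorm v < e /\
          patch (tr_tiling T1 u) (eball 0 e^-1) =
          patch (tr_tiling T2 v) (eball 0 e^-1)]
       `|` [set 1 / Num.sqrt 2]).

(* the tiling space Omega_T (the completion of the orbit, realized as the
   set of tilings, with tiles translates of tiles of T, that are limits of
   translates of T for the metric tdist) *)
Definition hull (d : nat) (T : set (set 'rV[R]_d)) : set (set (set 'rV[R]_d)) :=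
  [set T' | is_tiling T' /\
     (forall t', T' t' -> exists t x, T t /\ t' = tr_set t x) /\
     (forall e : R, 0 < e -> exists x, tdist T' (tr_tiling T x) < e)].

Definition dr (d : nat) (r : R) (T1 T2 : set (set 'rV[R]_d)) : \bar R :=
  ereal_inf [set e%:E | e in [set e : R | 0 < e /\ exists u : 'rV[R]_d,
      enorm u < e /\ patch (tr_tiling T1 u) (cball d r) = patch T2 (cball d r)]].

Definition iter_deriv (V W : normedModType R) (vs : seq V) (f : V -> W) : V -> W :=
  foldr (fun v g => fun y => derive g y v) f vs.
Definition smooth_on (V W : normedModType R) (A : set V) (f : V -> W) : Prop :=
  forall (vs : seq V) (x : V), A x -> differentiable (iter_deriv vs f) x.

Record param (X : Type) := Param {
  pdim : nat ;
  pdom : set 'rV[R]_pdim ;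
  pmap : 'rV[R]_pdim -> X }.
Arguments pdom {X} p _.
Arguments pmap {X} p _.

Definition is_param (X : Type) (Om : set X) (p : param X) : Prop :=
  open (pdom p) /\ (forall t, pdom p t -> Om (pmap p t)).

(* diffeology on Om (values outside the domain are irrelevant) *)
Definition is_diffeology (X : Type) (Om : set X) (D : set (param X)) : Prop :=
  (forall p, D p -> is_param Om p) /\
  (forall p, is_param Om p ->
     (exists c, forall t, pdom p t -> pmap p t = c) -> D p) /\
  (forall p, is_param Om p ->
     (forall t, pdom p t -> exists W : set 'rV[R]_(pdim p),
         open W /\ W t /\ W `<=` pdom p /\ D (@Param X (pdim p) W (pmap p))) ->
     D p) /\
  (forall p (m : nat) (V : set 'rV[R]_m) (f : 'rV[R]_m -> 'rV[R]_(pdim p))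
          (q : 'rV[R]_m -> X),
     D p -> open V -> smooth_on V f -> (forall t, V t -> pdom p (f t)) ->
     (forall t, V t -> q t = pmap p (f t)) -> D (@Param X m V q)).

Definition gen_diffeology (X : Type) (Om : set X) (F : set (param X))
  : set (param X) :=
  [set p | forall D, is_diffeology Om D -> F `<=` D -> D p].

Definition translation_family (d : nat) (T : set (set 'rV[R]_d))
  : set (param (set (set 'rV[R]_d))) :=
  [set q | exists T1, hull T T1 /\
     q = @Param _ d setT (fun x => tr_tiling T1 x)].

Definition dr_diffeology (d : nat) (T : set (set 'rV[R]_d))
  : set (param (set (set 'rV[R]_d))) :=
  [set p | is_param (hull T) p /\
    forall t0, pdom p t0 -> exists2 delta : R, 0 < delta &
      eball t0 delta `<=` pdom p /\
      (forall r : R, 0 < r ->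
         {within eball t0 delta,
            continuous (fun t => dr r (pmap p t0) (pmap p t))}) /\
      (forall t1, eball t0 delta t1 -> pmap p t1 <> pmap p t0 ->
         forall r : R, 0 < r ->
           (forall t, eball t0 delta t -> dr r (pmap p t1) (pmap p t) \is a fin_num) /\
           exists W : set 'rV[R]_(pdim p),
             open W /\ W t0 /\ W `<=` eball t0 delta /\
             smooth_on W (fun t => fine (dr r (pmap p t1) (pmap p t)) : R^o))].

End TilingDefs.

(* Main.v *)
Require Import Defs.
From HB Require Import structures.
From mathcomp Require Import all_boot all_order all_algebra.
From mathcomp Require Import all_classical all_reals all_analysis.
From mathcomp Require Import ring lra zify.
Set Implicit Arguments. Unset Strict Implicit. Unset Printing Implicit Defensive.
Import Order.TTheory GRing.Theory Num.Theory.
Import numFieldNormedType.Exports Defs.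
Local Open Scope ring_scope.

(** Both diffeologies consist of the parametrizations that locally have the form
[t |-> T1 + f t] with [f] smooth.

Tiles have nonempty interior, so a tiling [T1] is rigid: if [T1 + u] and [T1 + v]
agree on some ball and [u - v] is small, then [u = v]. Hence
[dr r (T1 + a) (T1 + b) = |b - a|] whenever [b - a] is small, for every [r], and
the translation plots satisfy both conditions on [dr].

Conversely, continuity of [t |-> dr r (p t0) (p t)] on a ball, combined with the gap
that rigidity leaves in the values of [dr r], gives [p t = p t0 + u t] near [t0] with
one vector [u t] for all radii. Smoothness of [|u t - u t1|] for all [t1] with
[u t1 <> 0] makes [u] smooth, by polarization.

Nonempty interior of a topological disk in dimension [d] is the only topological
input; it is derived from a combinatorial Poincare-Miranda theorem, itself a discrete
Stokes formula modulo 2. *)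

(** * A combinatorial Poincare-Miranda theorem *)

(** Tiles are bare topological disks, so disjointness of interiors says nothing until an interior
    point is at hand. A closed set with empty interior can be kept off the vertices of a grid, and
    Lebesgue's covering argument then shows that it is not a disk; coefficients in ['F_2] spare the
    orientation signs.

    Two obstacles shape the converse. Continuity at [t0] alone would give, for each radius, a
    neighbourhood that may shrink as the radius grows; [delta] is common to all radii, and
    connectedness of segments turns this into one neighbourhood. And condition (2) excludes every
    [t1] with [p t1 = p t0], because [|u t|] need not be smooth where [u] vanishes. So [|u t|^2]
    cannot enter the polarization, and only the products of [u t] with differences of two nonzero
    values are known to be smooth. *)

Section Char2Sums.
Variables (I : finType) (V : zmodType).
Hypothesis addvv : forall x : V, x + x = 0.

Lemma sum_offdiag_swap (S : {set I}) (G : I -> I -> V) :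
  \sum_(j in S) \sum_(i in S :\ j) G j i = \sum_(j in S) \sum_(i in S :\ j) G i j.
Proof.
rewrite (exchange_big_dep (mem S)) /=; last by move=> j i _; rewrite in_setD1 => /andP[].
apply: eq_bigr => j jS; apply: eq_bigl => i.
by rewrite !in_setD1 eq_sym jS andbT andbC.
Qed.

(** Each unordered pair contributes its term twice; [enum_rank] selects one of the two orders. *)
Lemma sum_offdiag_sym (S : {set I}) (G : I -> I -> V) :
  (forall i j, G i j = G j i) -> \sum_(j in S) \sum_(i in S :\ j) G j i = 0.
Proof.
move=> symG; rewrite pair_big_dep /=.
pose lt (p : I * I) := (enum_rank p.1 < enum_rank p.2)%N.
rewrite (bigID lt) /= [X in _ + X](reindex_inj (h := fun p : I * I => (p.2, p.1))) /=; last first.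
  by move=> [a b] [c e] [-> ->].
rewrite [X in _ + X](_ : _ = \sum_(p | (p.1 \in S) && (p.2 \in S :\ p.1) && lt p) G p.1 p.2) //.
apply: eq_big => [[a b]|[a b] _] /=; last by rewrite symG.
rewrite /lt /= !in_setD1 -leqNgt leq_eqVlt (inj_eq (inj_comp val_inj enum_rank_inj)).
case: (eqVneq a b) => [->|ab]; first by rewrite ltnn !andbF.
by rewrite ?ab /=; case: (a \in S); case: (b \in S).
Qed.
End Char2Sums.

Section CombinatorialPoincareMiranda.
Variable n : nat.
Notation pt := {ffun 'I_n -> nat}.
Notation F2 := 'F_2.
Implicit Types (z w : pt) (i j a : 'I_n) (S : {set 'I_n}) (l : seq 'I_n) (s : seq (pt -> F2)).

Definition upd z j (m : nat) : pt := [ffun i => if i == j then m else z i].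
Definition step z j : pt := upd z j (z j).+1.

Lemma upd_upd z j m m' : upd (upd z j m) j m' = upd z j m'.
Proof. by apply/ffunP => i; rewrite !ffunE; case: eqP. Qed.

Lemma updC z i j m m' : i != j -> upd (upd z i m) j m' = upd (upd z j m') i m.
Proof.
move=> ij; apply/ffunP => a; rewrite !ffunE.
by case: (eqVneq a j) => [->|//]; rewrite eq_sym (negPf ij).
Qed.

Lemma stepC z i j : step (step z i) j = step (step z j) i.
Proof.
apply/ffunP => a; rewrite !ffunE.
have [->|aj] := eqVneq a j; first by have [->|] := eqVneq j i; rewrite ?eqxx.
by have [ai|//] := eqVneq a i; rewrite -ai (negPf aj).
Qed.

Lemma F2_addvv (x : F2) : x + x = 0.
Proof. by apply: addrr_pchar2; rewrite pchar_Fp. Qed.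

(* The cubical cup product of the differentials of the functions in [s],
   evaluated on the cube with lowest vertex [z] spanned by the directions [S]. *)
Fixpoint cup s S z : F2 :=
  if s is f :: s' then
    \sum_(j in S) (f (step z j) + f z) * cup s' (S :\ j) (step z j)
  else 1.

(** A cup product of coboundaries is a cocycle. After one expansion of [cup], terms symmetric in [i]
    and [j] cancel modulo 2, and the induction hypothesis moves the base vertex of the others. *)
Lemma cup_closed s S z :
  \sum_(j in S) cup s (S :\ j) (step z j) = \sum_(j in S) cup s (S :\ j) z.
Proof.
elim: s S z => [//|f s IH] S z /=.
have setDD i j : S :\ i :\ j = S :\ j :\ i by rewrite !finset.setDDl finset.setUC.
transitivity (\sum_(j in S) \sum_(i in S :\ j) f (step z j) * cup s (S :\ j :\ i) (step z j)).
  rewrite (eq_bigr (fun j =>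
     \sum_(i in S :\ j) f (step (step z j) i) * cup s (S :\ j :\ i) (step (step z j) i) +
     \sum_(i in S :\ j) f (step z j) * cup s (S :\ j :\ i) (step (step z j) i))); last first.
    by move=> j _; rewrite -big_split; apply: eq_bigr => i _; rewrite /= mulrDl.
  rewrite big_split /= sum_offdiag_sym; [|exact: F2_addvv|]; last first.
    by move=> i j; rewrite stepC setDD.
  by rewrite add0r; apply: eq_bigr => j _; rewrite -!mulr_sumr IH.
rewrite [RHS](eq_bigr (fun j =>
     \sum_(i in S :\ j) f (step z i) * cup s (S :\ j :\ i) (step z i) +
     \sum_(i in S :\ j) f z * cup s (S :\ j :\ i) (step z i))); last first.
  by move=> j _; rewrite -big_split; apply: eq_bigr => i _; rewrite /= mulrDl.
rewrite big_split /= [X in _ = _ + X]sum_offdiag_swap.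
rewrite [X in _ = _ + X](_ : _ = 0) ?addr0.
  rewrite [RHS]sum_offdiag_swap; apply: eq_bigr => j _; apply: eq_bigr => i _.
  by rewrite setDD.
rewrite (eq_bigr (fun j => \sum_(i in S :\ j) f z * cup s (S :\ j :\ i) (step (step z j) i))).
  by apply: sum_offdiag_sym; [exact: F2_addvv|move=> i j; rewrite stepC setDD].
move=> j _; rewrite -!mulr_sumr IH; congr (_ * _).
by apply: eq_bigr => i _; rewrite setDD.
Qed.

Variable k : nat.

(** Coordinates outside [l] keep their value in [z], so the same sum also describes the faces of the
    box. *)
Fixpoint boxsum l (F : pt -> F2) z : F2 :=
  if l is j :: l' then \sum_(m < k) boxsum l' F (upd z j m) else F z.

Lemma eq_boxsum l F G z : F =1 G -> boxsum l F z = boxsum l G z.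
Proof. by move=> FG; elim: l z => [|j l IH] z /=; [exact: FG|apply: eq_bigr]. Qed.

Lemma boxsumD l F G z :
  boxsum l (fun w => F w + G w) z = boxsum l F z + boxsum l G z.
Proof.
by elim: l z => [//|j l IH] z /=; rewrite -big_split; apply: eq_bigr.
Qed.

Lemma boxsum_sum l (S : {set 'I_n}) (F : 'I_n -> pt -> F2) z :
  boxsum l (fun w => \sum_(j in S) F j w) z = \sum_(j in S) boxsum l (F j) z.
Proof.
elim: l z => [//|j l IH] z /=; rewrite exchange_big; apply: eq_bigr => m _.
exact: IH.
Qed.

Lemma boxsum0 l z : boxsum l (fun=> 0) z = 0.
Proof. by elim: l z => [//|j l IH] z /=; rewrite big1. Qed.

Lemma boxsum_upd l F z j m : j \notin l ->
  boxsum l F (upd z j m) = boxsum l (fun w => F (upd w j m)) z.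
Proof.
elim: l z => [//|i l IH] z /=; rewrite in_cons negb_or => /andP[ji jl].
by apply: eq_bigr => p _; rewrite updC // IH.
Qed.

Lemma boxsum_telescope l h z j : uniq l -> j \in l ->
  boxsum l (fun w => h (step w j) + h w) z =
  boxsum (rem j l) (fun w => h (upd w j k) + h (upd w j 0%N)) z.
Proof.
elim: l z => [//|i l IH] z /= /andP[il ul]; rewrite in_cons eq_sym.
case: (eqVneq i j) => [<- _|ij /= jl]; last by apply: eq_bigr => m _; rewrite IH.
pose B m := boxsum l (fun w => h (upd w i m)) z.
rewrite (eq_bigr (fun m : 'I_k => B m.+1 + B m)); last first.
  move=> m _; rewrite boxsumD; congr (_ + _); rewrite boxsum_upd //.
  by apply: eq_boxsum => w; rewrite /step upd_upd ffunE eqxx.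
rewrite boxsumD -/(B k) -/(B 0%N).
elim: k (B) => [|p IHp] {}B; first by rewrite big_ord0 F2_addvv.
by rewrite big_ord_recr /= IHp addrC addrA -(addrA (B p.+1)) F2_addvv addr0.
Qed.

Lemma boxsum_neq0 l F z : boxsum l F z != 0 ->
  exists w, [/\ F w != 0, forall i, i \in l -> (w i < k)%N
                       & forall i, i \notin l -> w i = z i].
Proof.
elim: l z => [|j l IH] z /=; first by exists z.
move=> nz; case: (pickP (fun m : 'I_k => boxsum l F (upd z j m) != 0)) => [m /IH|all0].
  case=> w [Fw wl wn]; exists w; split=> // i; rewrite in_cons.
    case: (boolP (i \in l)) => [/wl //|/wn ->]; rewrite orbF => /eqP ->.
    by rewrite ffunE eqxx.
  by rewrite negb_or => /andP[/negPf ij /wn ->]; rewrite ffunE ij.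
by case/eqP: nz; rewrite big1 // => m _; apply/eqP; rewrite -[_ == _]negbK all0.
Qed.

Variable sigma : 'I_n -> pt -> F2.
Hypothesis sigma_top : forall i z, z i = k -> sigma i z = 1.
Hypothesis sigma_bot : forall i z, z i = 0%N -> sigma i z = 0.

(** Inside a face orthogonal to [j] every step fixes coordinate [j], so the factor of [sigma j] is
    the coboundary of a constant. *)
Lemma cup_const_eq0 l S z j : j \in l -> j \notin S ->
  (forall w, w j = z j -> sigma j w = sigma j z) -> cup (map sigma l) S z = 0.
Proof.
elim: l S z => [//|a l IH] S z /=; rewrite in_cons eq_sym => jal jS cj.
rewrite big1 // => i iS.
have stepj : step z i j = z j.
  by rewrite ffunE; case: eqP => // ji; rewrite ji iS in jS.
case: (eqVneq a j) jal => [-> _|aj /= jl]; first by rewrite cj // F2_addvv mul0r.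
rewrite IH ?mulr0 //; first by rewrite in_setD1 (negPf jS) andbF.
by move=> w; rewrite stepj => wj; rewrite cj // -(cj (step z i)).
Qed.

(* Discrete Stokes: by closedness the sum telescopes to the faces, and only
   the top face in the direction of the head of [l] contributes. *)
Lemma boxsum_cup l z : uniq l ->
  boxsum l (cup (map sigma l) [set i in l]) z = 1.
Proof.
elim: l z => [//|a l IH] z /= /andP[al ul].
pose S := [set i in a :: l].
(* A primitive of the cup product: the head factor enters as [sigma a] itself, not as its
   coboundary. [cup_closed] allows both factors to be read at the same vertex. *)
pose h j w := sigma a w * cup (map sigma l) (S :\ j) w.
have ual : uniq (a :: l) by rewrite /= al.
rewrite -/(boxsum (a :: l) (cup (map sigma (a :: l)) S) z).
rewrite (@eq_boxsum _ _ (fun w => \sum_(j in S) (h j (step w j) + h j w))); last first.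
  move=> w /=; rewrite big_split /= -mulr_sumr -cup_closed mulr_sumr -big_split /=.
  by apply: eq_bigr => j _; rewrite mulrDl.
rewrite boxsum_sum (eq_bigr (fun j => boxsum (rem j (a :: l))
  (fun w => h j (upd w j k) + h j (upd w j 0%N)) z)); last first.
  by move=> j; rewrite inE => jl; apply: boxsum_telescope.
rewrite (bigD1 a) ?inE ?eqxx // big1 => [|j].
  rewrite /= eqxx.
  have Sa : S :\ a = [set i in l].
    by apply/setP => i; rewrite !inE; case: eqVneq => // ->; rewrite (negPf al).
  rewrite addr0 -[RHS](IH (upd z a k)) // boxsum_upd //; apply: eq_boxsum => w.
  by rewrite /h Sa sigma_top ?sigma_bot ?ffunE ?eqxx // mul0r mul1r addr0.
rewrite !inE => /andP[/orP[/eqP ->|jl] ja]; first by rewrite eqxx in ja.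
rewrite -[RHS](boxsum0 (rem j (a :: l)) z); apply: eq_boxsum => w.
have h0 c : c = k \/ c = 0%N -> h j (upd w j c) = 0.
  move=> ck; rewrite /h (cup_const_eq0 (j := j)) ?mulr0 ?in_setD1 ?eqxx // => v.
  rewrite ffunE eqxx => vj; have uj : upd w j c j = c by rewrite ffunE eqxx.
  by case: ck vj uj => -> vj uj; [rewrite !sigma_top|rewrite !sigma_bot].
by rewrite !h0 ?addr0; auto.
Qed.

Lemma cup_neq0_edge l S z i : cup (map sigma l) S z != 0 -> i \in l ->
  exists w w', [/\ forall j, (z j <= w j <= (z j).+1)%N,
    forall j, (z j <= w' j <= (z j).+1)%N & sigma i w != sigma i w'].
Proof.
(* Confining both vertices to the cube spanned by [S] ensures that a step along [j], followed by
   moves in [S :\ j], never passes [(z j).+1]. *)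
suff gen : cup (map sigma l) S z != 0 -> i \in l ->
    exists w w', [/\ forall j, (z j <= w j <= z j + (j \in S))%N,
    forall j, (z j <= w' j <= z j + (j \in S))%N & sigma i w != sigma i w'].
  move=> cz il; have [w [w' [hw hw' ww]]] := gen cz il.
  have leS j : (z j + (j \in S) <= (z j).+1)%N by rewrite -addn1 leq_add2l leq_b1.
  by exists w, w'; split=> // j; [case/andP: (hw j)|case/andP: (hw' j)] => -> /leq_trans ->.
elim: l S z => [//|a l IH] S z /= cz.
have [j jS] : exists2 j, j \in S & (sigma a (step z j) + sigma a z) *
    cup (map sigma l) (S :\ j) (step z j) != 0.
  case: (pickP (fun j => (j \in S) && ((sigma a (step z j) + sigma a z) *
    cup (map sigma l) (S :\ j) (step z j) != 0))) => [j /andP[jS jz]|all0]; first by exists j.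
  case/eqP: cz; rewrite big1 // => j jS; apply/eqP; rewrite -[_ == _]negbK.
  by have := all0 j; rewrite /= jS /= => ->.
rewrite mulf_eq0 negb_or => /andP[sz cz'].
have stepS b : (z b <= step z j b <= z b + (b \in S))%N.
  by rewrite ffunE; case: eqVneq => [->|_]; rewrite ?jS ?addn1 ?leqnSn ?leqnn ?leq_addr.
rewrite in_cons; case: (eqVneq i a) => [-> _|_ /= il].
  exists (step z j), z; split=> // [b|]; first by rewrite leqnn leq_addr.
  by apply: contra sz => /eqP ->; rewrite F2_addvv.
have [w [w' [hw hw' ww]]] := IH _ _ cz' il.
have sub v : (forall b, (step z j b <= v b <= step z j b + (b \in S :\ j))%N) ->
    forall b, (z b <= v b <= z b + (b \in S))%N.
  move=> hv b; have /andP[h1 h2] := hv b.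
  rewrite (leq_trans _ h1) ?(leq_trans h2) //; last by case/andP: (stepS b).
  rewrite ffunE in_setD1; case: eqVneq => [->|_]; first by rewrite jS addn0 addn1.
  by [].
by exists w, w'; split=> //; apply: sub.
Qed.

End CombinatorialPoincareMiranda.

(** The cup product sums to 1 over the box, so it is nonzero on some cell; there each factor needs
    an edge along which its [sigma i] changes. *)
Lemma discrete_poincare_miranda (n k : nat)
    (sigma : 'I_n -> {ffun 'I_n -> nat} -> bool) :
  (forall i (z : {ffun 'I_n -> nat}), z i = k -> sigma i z) ->
  (forall i (z : {ffun 'I_n -> nat}), z i = 0%N -> ~~ sigma i z) ->
  exists z : {ffun 'I_n -> nat}, (forall i, (z i < k)%N) /\
    forall i, exists w w' : {ffun 'I_n -> nat},
      [/\ forall j, (z j <= w j <= (z j).+1)%N,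
          forall j, (z j <= w' j <= (z j).+1)%N & sigma i w != sigma i w'].
Proof.
move=> top bot; pose s i (z : {ffun 'I_n -> nat}) : 'F_2 := (sigma i z)%:R.
have stop i (z : {ffun 'I_n -> nat}) : z i = k -> s i z = 1 by move/top; rewrite /s => ->.
have sbot i (z : {ffun 'I_n -> nat}) : z i = 0%N -> s i z = 0 by move/bot; rewrite /s => /negPf ->.
have := boxsum_cup stop sbot [ffun=> 0%N] (enum_uniq 'I_n).
move=> e1; have /boxsum_neq0 [z [cz zk _]] :
    boxsum k (enum 'I_n) (cup (map s (enum 'I_n)) [set i in enum 'I_n]) [ffun=> 0%N] != 0.
  by rewrite e1 oner_eq0.
exists z; split=> [i|i]; first by apply: zk; rewrite mem_enum.
have [w [w' [hw hw' sw]]] := cup_neq0_edge cz (mem_enum 'I_n i).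
by exists w, w'; split=> //; apply: contra sw => /eqP; rewrite /s => ->.
Qed.

Local Open Scope classical_set_scope.
Local Open Scope ring_scope.

(** * The Euclidean norm *)

Section Euclidean.
Variable R : realType.
Implicit Types (n : nat).

Lemma coord_le_norm n (x : 'rV[R]_n) i : `|x ord0 i| <= `|x|.
Proof.
rewrite [leRHS]/Num.Def.normr /= mx_normrE.
by apply: (le_bigmax _ (fun ij => `|x ij.1 ij.2|) (ord0, i)).
Qed.

Lemma norm_rV_le n (x : 'rV[R]_n) e : 0 <= e ->
  (forall i, `|x ord0 i| <= e) -> `|x| <= e.
Proof.
move=> e0 xe; rewrite [leLHS]/Num.Def.normr /= mx_normrE.
by apply: bigmax_le => // -[i j] _ /=; rewrite (ord1 i).
Qed.

Lemma norm_rV_lt n (x : 'rV[R]_n) e : 0 < e ->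
  (forall i, `|x ord0 i| < e) -> `|x| < e.
Proof.
move=> e0 xe; rewrite [ltLHS]/Num.Def.normr /= mx_normrE.
by apply: bigmax_lt => // -[i j] _ /=; rewrite (ord1 i).
Qed.

Lemma enorm_ge0 n (x : 'rV[R]_n) : 0 <= enorm x.
Proof. exact: sqrtr_ge0. Qed.

Lemma sum_sqr_ge0 n (x : 'rV[R]_n) : 0 <= \sum_(i < n) x ord0 i ^+ 2.
Proof. by apply: sumr_ge0 => i _; apply: sqr_ge0. Qed.

Lemma enorm_sqr n (x : 'rV[R]_n) : enorm x ^+ 2 = \sum_(i < n) x ord0 i ^+ 2.
Proof. by rewrite sqr_sqrtr // sum_sqr_ge0. Qed.

Lemma coord_le_enorm n (x : 'rV[R]_n) i : `|x ord0 i| <= enorm x.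
Proof.
rewrite -sqrtr_sqr ler_wsqrtr // (bigD1 i) //= lerDl.
by apply: sumr_ge0 => j _; apply: sqr_ge0.
Qed.

Lemma norm_le_enorm n (x : 'rV[R]_n) : `|x| <= enorm x.
Proof. by apply: norm_rV_le; [exact: enorm_ge0|exact: coord_le_enorm]. Qed.

Lemma enorm_le_norm n (x : 'rV[R]_n) : enorm x <= n%:R * `|x|.
Proof.
have nx0 : 0 <= n%:R * `|x| by rewrite mulr_ge0.
rewrite -(ler_pXn2r (n := 2)) ?nnegrE ?enorm_ge0 // enorm_sqr.
apply: (@le_trans _ _ (\sum_(i < n) `|x| ^+ 2)).
  apply: ler_sum => i _; rewrite -real_normK ?num_real //.
  by rewrite lerXn2r ?nnegrE ?coord_le_norm.
rewrite sumr_const card_ord exprMn -[leLHS]mulr_natl ler_wpM2r ?sqr_ge0 //.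
by rewrite -natrX ler_nat; case: n {x nx0} => // n; rewrite expnS expn1 leq_pmulr.
Qed.

Lemma enorm0 n : enorm (0 : 'rV[R]_n) = 0.
Proof. by rewrite /enorm big1 ?sqrtr0 // => i _; rewrite mxE expr0n. Qed.

Lemma enorm_eq0 n (x : 'rV[R]_n) : enorm x = 0 -> x = 0.
Proof.
move=> x0; apply/eqP; rewrite -normr_eq0 eq_le normr_ge0 andbT -x0.
exact: norm_le_enorm.
Qed.

Lemma enormN n (x : 'rV[R]_n) : enorm (- x) = enorm x.
Proof. by congr Num.sqrt; apply: eq_bigr => i _; rewrite mxE sqrrN. Qed.

Lemma enormBC n (x y : 'rV[R]_n) : enorm (x - y) = enorm (y - x).
Proof. by rewrite -opprB enormN. Qed.

Lemma enormZ n (a : R) (x : 'rV[R]_n) : enorm (a *: x) = `|a| * enorm x.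
Proof.
rewrite -sqrtr_sqr /enorm -sqrtrM ?sqr_ge0 // mulr_sumr.
by congr Num.sqrt; apply: eq_bigr => i _; rewrite mxE exprMn.
Qed.

(** Lagrange's identity: the double sum of squares is twice the gap between the two sides. *)
Lemma cauchy_schwarz_sum n (x y : 'I_n -> R) :
  (\sum_i x i * y i) ^+ 2 <= (\sum_i x i ^+ 2) * (\sum_i y i ^+ 2).
Proof.
have : 0 <= \sum_i \sum_j (x i * y j - x j * y i) ^+ 2.
  by apply: sumr_ge0 => i _; apply: sumr_ge0 => j _; apply: sqr_ge0.
rewrite (eq_bigr (fun i => x i ^+ 2 * (\sum_j y j ^+ 2) +
   (y i ^+ 2 * (\sum_j x j ^+ 2) - 2 * (x i * y i) * (\sum_j x j * y j)))).
  by rewrite big_split sumrB /= -!mulr_suml -mulr_sumr; nra.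
move=> i _; rewrite !mulr_sumr -sumrB -big_split /=.
by apply: eq_bigr => j _; ring.
Qed.

Lemma enormD n (x y : 'rV[R]_n) : enorm (x + y) <= enorm x + enorm y.
Proof.
have x0 := enorm_ge0 x; have y0 := enorm_ge0 y.
rewrite -(ler_pXn2r (n := 2)) ?nnegrE ?enorm_ge0 ?addr_ge0 // sqrrD !enorm_sqr.
have -> : \sum_(i < n) (x + y) ord0 i ^+ 2 = \sum_(i < n) x ord0 i ^+ 2 +
   (\sum_(i < n) x ord0 i * y ord0 i) *+ 2 + \sum_(i < n) y ord0 i ^+ 2.
  by rewrite -sumrMnl -!big_split /=; apply: eq_bigr => i _; rewrite mxE sqrrD.
rewrite lerD2r lerD2l lerMn2r /=; apply: le_trans (ler_norm _) _.
rewrite -(ler_pXn2r (n := 2)) ?nnegrE ?mulr_ge0 // real_normK ?num_real //.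
by rewrite exprMn !enorm_sqr cauchy_schwarz_sum.
Qed.

Lemma enorm_lt_trans n (x y z : 'rV[R]_n) a b :
  enorm (x - y) < a -> enorm (y - z) < b -> enorm (x - z) < a + b.
Proof.
move=> xy yz; rewrite -(subrKA y) (le_lt_trans (enormD _ _)) // ltrD //.
Qed.

Lemma open_eball n (c : 'rV[R]_n) r : open (eball c r).
Proof.
rewrite openE => x /= xc; apply/nbhs_ballP.
pose e := (r - enorm (x - c)) / n.+1%:R.
have e0 : 0 < e by rewrite divr_gt0 // subr_gt0.
exists e => //= y; rewrite -ball_normE /= => xy.
rewrite /eball /= -(subrKA x) (le_lt_trans (enormD _ _)) // -ltrBrDr.
apply: le_lt_trans (enorm_le_norm _) _; rewrite distrC in xy.
apply: (@le_lt_trans _ _ (n%:R * e)); first by rewrite ler_wpM2l // ltW.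
rewrite /e mulrCA gtr_pMr ?subr_gt0 // ltr_pdivrMr ?ltr0n // mul1r ltr_nat.
exact: ltnSn.
Qed.

Lemma eball_subset_ball n (c : 'rV[R]_n) r : eball c r `<=` ball c r.
Proof.
move=> x; rewrite /eball -ball_normE /= distrC; apply: le_lt_trans.
exact: norm_le_enorm.
Qed.

Lemma eball_center n (c : 'rV[R]_n) r : 0 < r -> eball c r c.
Proof. by move=> r0; rewrite /eball /= subrr enorm0. Qed.

Lemma nbhs_eballP n (c : 'rV[R]_n) (A : set 'rV[R]_n) :
  nbhs c A <-> exists2 e : R, 0 < e & eball c e `<=` A.
Proof.
split=> [/nbhs_ballP[e e0 eA]|[e e0 eA]].
  by exists e => //; apply: subset_trans eA; apply: eball_subset_ball.
by apply: filterS eA _; apply: open_nbhs_nbhs; split; [exact: open_eball|exact: eball_center].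
Qed.

Lemma continuous_enorm n : continuous (@enorm R n).
Proof.
move=> x; apply/(cvgrPdist_lt (FF := nbhs_filter x)) => e e0.
near=> y; have xy : eball x e y by near: y; apply/nbhs_eballP; exists e.
rewrite ltr_norml.
have := enormD (y - x) x; have := enormD (x - y) y; rewrite !subrK.
by rewrite (enormBC x y); rewrite /eball /= in xy; lra.
Unshelve. all: by end_near. Qed.

Lemma compact_cball n (r : R) : compact (@cball R n r).
Proof.
apply: bounded_closed_compact.
  exists r; split; first exact: num_real.
  move=> M rM x xr; apply: le_trans (norm_le_enorm _) _.
  exact: le_trans xr (ltW rM).
have -> : @cball R n r = @enorm R n @^-1` [set y | y <= r] by [].
by move/continuous_closedP: (@continuous_enorm n); apply; apply: closed_le.
Qed.

End Euclidean.

Lemma compact_uniform_continuous (R : realType) (V W : normedModType R)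
    (K : set V) (f : V -> W) (e : R) :
  compact K -> {within K, continuous f} -> 0 < e ->
  exists2 del : R, 0 < del &
    forall x y, K x -> K y -> `|x - y| < del -> `|f x - f y| < e.
Proof.
move=> cK cf e0; move/compact_near_coveringP: cK => /(_ R (0^'+)
  (fun del x => K x -> forall y, K y -> `|x - y| < del -> `|f x - f y| < e)) [].
  move=> x Kx; have e20 : 0 < e / 2 by rewrite divr_gt0.
  move/subspace_continuousP: cf => /(_ x Kx) /cvgrPdist_lt /(_ _ e20).
  rewrite near_withinE => /nbhs_ballP[eta eta0 H].
  exists (ball x (eta / 2), [set del | del < eta / 2]).
    split; first by apply: nbhsx_ballx; rewrite divr_gt0.
    by apply: nbhs_right_lt; rewrite divr_gt0.
  move=> [z del] /= [xz deleta] Kz y Ky zy.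
  rewrite -ball_normE /= in xz.
  have h1 : `|f x - f z| < e / 2.
    apply: H => //; rewrite -ball_normE /=; apply: lt_trans xz _.
    by rewrite ltr_pdivrMr // ltr_pMr // ltr1n.
  have h2 : `|f x - f y| < e / 2.
    apply: H => //; rewrite -ball_normE /=.
    by rewrite -(subrKA z) (splitr eta) (le_lt_trans (ler_normD _ _)) // ltrD // (lt_trans zy).
  by rewrite -(subrKA (f x)) (splitr e) (le_lt_trans (ler_normD _ _)) // ltrD // distrC.
move=> del /= del0 H; exists (del / 2); first by rewrite divr_gt0.
move=> x y Kx Ky xy; apply: (H (del / 2)) => //=; last by rewrite divr_gt0.
by rewrite sub0r normrN gtr0_norm ?divr_gt0 // ltr_pdivrMr // ltr_pMr // ltr1n.
Qed.

(** * Interior of topological disks *)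

Section DiskInterior.
Variable R : realType.

(** One vector at a time: the current ball around [c + v] contains a point off [t], hence a smaller
    ball off [t]. Shrinking keeps the earlier vectors avoided. *)
Lemma closed_nowhere_dense_avoid (V : normedModType R) (t : set V) (s : seq V)
    (c0 : V) (eta : R) :
  closed t -> interior t = set0 -> 0 < eta ->
  exists c (rho : R), [/\ 0 < rho, `|c - c0| + rho <= eta &
    forall v x, v \in s -> `|x - c| < rho -> ~ t (x + v)].
Proof.
move=> clt int0 eta0; elim: s => [|v s [c [rho [rho0 crho av]]]].
  by exists c0, eta; split=> //; rewrite subrr normr0 add0r.
have [y cy nty] : exists2 y, `|y - (c + v)| < rho & ~ t y.
  apply: contrapT => H; suff : interior t (c + v) by rewrite int0.
  apply/nbhs_ballP; exists rho => // y; rewrite -ball_normE /= distrC => yc.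
  by apply: contrapT => nty; apply: H; exists y.
have /nbhs_ballP [r1 /= r10 Hr1] : nbhs y (~` t).
  by apply: open_nbhs_nbhs; split=> //; apply: closed_openC.
have e1 : `|y - v - c| < rho by rewrite -addrA -opprD (addrC v).
exists (y - v), (Num.min r1 (rho - `|y - v - c|)); split.
- by rewrite lt_min r10 subr_gt0.
- have := ler_distD c (y - v) c0.
  have : Num.min r1 (rho - `|y - v - c|) <= rho - `|y - v - c| by rewrite ge_min lexx orbT.
  by lra.
move=> w x; rewrite in_cons lt_min => /orP[/eqP -> /andP[xr _]|ws /andP[_ xr]].
  apply: (Hr1 (x + v)); rewrite -ball_normE /= distrC.
  by move: xr; rewrite opprB addrA.
apply: av ws _; have := ler_distD (y - v) x c; lra.
Qed.

Lemma floor_eq_dist (a b : R) : Num.floor a = Num.floor b -> `|a - b| < 1.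
Proof.
move=> ab; have /andP[a1 a2] := floor_itv a; have /andP[b1 b2] := floor_itv b.
by rewrite ab in a1 a2; rewrite intrD in a2 b2; rewrite ltr_norml; lra.
Qed.

Lemma floor_neq_dist (a b : R) : Num.floor a <> Num.floor b ->
  exists m : int, `|a - m%:~R| <= `|a - b|.
Proof.
move=> ab; have /andP[a1 a2] := floor_itv a; have /andP[b1 b2] := floor_itv b.
have [fab|fba|//] := ltgtP (Num.floor a) (Num.floor b).
  exists (Num.floor b); have : (Num.floor a + 1)%:~R <= (Num.floor b)%:~R :> R.
    by rewrite ler_int lezD1.
  move=> h; rewrite ler_norml; have := ler_norm (b - a); rewrite distrC; lra.
exists (Num.floor a); have : (Num.floor b + 1)%:~R <= (Num.floor a)%:~R :> R.
  by rewrite ler_int lezD1.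
move=> h; rewrite ler_norml; have := ler_norm (a - b); lra.
Qed.

Lemma minn_succ (a b k : nat) : (a < k)%N -> (a <= b <= a.+1)%N ->
  minn a k = a /\ (minn b k = a \/ minn b k = a.+1).
Proof. lia. Qed.

(** In the application the walls of the [i]-th shifted grid sit at positions congruent to [i] modulo
    [d], so walls that are close belong to the same grid. *)
Lemma residue_inj (d i j : nat) (u v : int) : (i < d)%N -> (j < d)%N ->
  `|(i%:Z + d%:Z * u) - (j%:Z + d%:Z * v)| < 1 -> i = j.
Proof.
wlog uv : i j u v / u <= v => [H id_ jd e|id_ jd e].
  case: (leP u v) => [|/ltW] uv; first exact: H uv id_ jd e.
  by apply/esym; apply: H uv jd id_ _; rewrite distrC.
have [k vE] : exists k : nat, v = u + k%:Z by exists `|v - u|%N; lia.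
have : (i%:Z + d%:Z * u) = (j%:Z + d%:Z * v) by lia.
by case: k vE => [|k] ->; [lia|nia].
Qed.

Lemma absz_shift (N : nat) (x : int) : - N%:Z < x < N%:Z ->
  (absz (x + N%:Z)%R < N.*2.+1)%N /\ (absz (x + N%:Z))%:Z = x + N%:Z.
Proof. lia. Qed.

Lemma homeomorphic_disk_compact d (t : set 'rV[R]_d) :
  homeomorphic t (@cball R d 1) -> compact t.
Proof.
move=> [f [g [fB [gA [gf [fg [cf cg]]]]]]].
have -> : t = g @` cball 1.
  apply/seteqP; split=> [x tx|_ [y By <-]]; last exact: gA.
  by exists (f x); [exact: fB|exact: gf].
by apply: continuous_compact cg _; apply: compact_cball.
Qed.

(* If [t] had no interior, fine shifted grids with vertices off [t] would
   separate opposite faces of a cube in the disk by sets with no common point. *)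
Lemma homeomorphic_disk_interior d (t : set 'rV[R]_d) : (0 < d)%N ->
  homeomorphic t (@cball R d 1) -> interior t !=set0.
Proof.
move=> d0 hom; have ct := homeomorphic_disk_compact hom.
move: hom => [f [g [fB [gA [gf [fg [cf cg]]]]]]].
apply: contrapT => /set0P/negP/negPn/eqP int0.
have clt : closed t by apply: compact_closed ct; exact: norm_hausdorff.
have [M bM] : exists M : R, forall y, t y -> `|y| <= M.
  have [M0 [_ bM]] := compact_bounded ct.
  by exists (M0 + 1) => y ty; apply: bM ty; rewrite ltrDl.
have dR : 0 < d%:R :> R by rewrite ltr0n.
(* The cube of half-side [s = 1 / d] lies in the unit disk, as [enorm] is at most [d] times the sup
   norm. *)
have [s s0 ds] : exists2 s : R, 0 < s & d%:R * s = 1.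
  by exists d%:R^-1; rewrite ?invr_gt0 // mulfV // gt_eqF.
(* Points of [t] closer than [h] cannot come from opposite faces of the cube, which are [2 * s]
   apart. *)
have [|h h0 fh] := @compact_uniform_continuous _ _ _ t f (2 * s) ct cf.
  by rewrite mulr_gt0.
have [N hN] : exists N : nat, d%:R * (M + 3) / h < N%:R.
  by exists (Num.truncn (d%:R * (M + 3) / h)).+1; apply: truncnS_gt.
(* The walls of all [d] shifted grids lie at multiples of [h * s = h / d] from [c]; [N] bounds the
   multiples that occur near [t]. *)
pose V := [seq \row_j (h * s * ((m j)%:R - N%:R)) | m : {ffun 'I_d -> 'I_(N.*2.+1)}].
have [|c [rho [rho0 crho avoid]]] := @closed_nowhere_dense_avoid _ t V 0 1 clt int0.
  by [].
rewrite subr0 in crho.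
have hs0 : 0 < h * s by rewrite mulr_gt0.
(* The final distance to a grid vertex will be [3 * r1], which must be below [rho]; [6 * r1] below
   [h * s] separates walls of different grids. *)
have [r1 [r10 r1rho r1hs]] : exists r1 : R, [/\ 0 < r1, 4 * r1 <= rho & 8 * r1 <= h * s].
  exists (Num.min (rho / 4) (h * s / 8)); split; first by rewrite lt_min !divr_gt0.
    by rewrite mulrC -ler_pdivlMr // ge_min lexx.
  by rewrite mulrC -ler_pdivlMr // ge_min lexx orbT.
have [del del0 gdel] := @compact_uniform_continuous _ _ _ _ g r1 (@compact_cball R d 1) cg r10.
have [k hk] : exists k : nat, 2 * s / del < k%:R.
  by exists (Num.truncn (2 * s / del)).+1; apply: truncnS_gt.
have k0 : 0 < k%:R :> R by apply: lt_trans hk; rewrite divr_gt0 // mulr_gt0.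
(* Clamping with [minn] sends every integer point into the cube, including those beyond the box. *)
pose X (z : {ffun 'I_d -> nat}) : 'rV[R]_d :=
  \row_j (- s + 2 * s * (minn (z j) k)%:R / k%:R).
have XB z : cball 1 (X z).
  rewrite /cball /=; apply: le_trans (enorm_le_norm _) _; rewrite -[leRHS]ds.
  apply: ler_wpM2l; first exact: ltW.
  apply: norm_rV_le => [|j]; first exact: ltW.
  rewrite mxE ler_norml; have h1 : 0 <= (minn (z j) k)%:R / k%:R :> R by rewrite divr_ge0.
  have h2 : (minn (z j) k)%:R / k%:R <= 1 :> R by rewrite ler_pdivrMr // mul1r ler_nat geq_minr.
  by rewrite -mulrA; nra.
(* The cell of [y] in the grid of side [h] based at [c] and displaced by [i * h * s] in every
   coordinate; distinct [i] give grids without common walls in any coordinate. *)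
pose idx (i : 'I_d) (y : 'rV[R]_d) :=
  [ffun j => Num.floor ((y ord0 j - c ord0 j) / h - i%:R * s)] : {ffun 'I_d -> int}.
have idx_eq i y y' : idx i y = idx i y' -> `|y - y'| < h.
  move=> /ffunP e; apply: norm_rV_lt => // j; have := e j; rewrite !ffunE.
  move=> /floor_eq_dist; rewrite opprB addrA subrK -mulrBl normrM.
  by rewrite opprB addrA subrK normfV (gtr0_norm h0) ltr_pdivrMr // mul1r !mxE.
(* The colour tells whether [g (X z)] shares a cell with the image of the face [x_i = s]; the choice
   of [h] forbids this on the opposite face. *)
pose sigma i z := `[< exists x, [/\ cball 1 x, x ord0 i = s & idx i (g (X z)) = idx i (g x)] >].
have [||z [zk zsig]] := @discrete_poincare_miranda d k sigma.
- move=> i z zi; apply/asboolP; exists (X z); split=> //.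
  by rewrite mxE zi minnn mulfK ?gt_eqF //; lra.
- move=> i z zi; apply/asboolP => -[x [Bx xi /idx_eq]].
  move=> /(fh _ _ (gA _ (XB z)) (gA _ Bx)); rewrite !fg //.
  move=> /(le_lt_trans (coord_le_norm _ i)); rewrite !mxE zi min0n mulr0 mul0r xi.
  by rewrite ltr_norml; lra.
pose y := g (X z); have ty : t y by apply: gA.
have close (w : {ffun 'I_d -> nat}) :
    (forall j, (z j <= w j <= (z j).+1)%N) -> `|g (X w) - y| < r1.
  move=> hw; apply: gdel => //; apply: norm_rV_lt => // j; rewrite !mxE.
  rewrite opprD addrACA subrr add0r -mulrBl -mulrBr.
  have e1 : `|(minn (w j) k)%:R - (minn (z j) k)%:R| <= 1 :> R.
    have [-> [->|->]] := minn_succ (zk j) (hw j).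
      by rewrite subrr normr0.
    by rewrite -natr1 addrAC subrr add0r normr1.
  rewrite !normrM normfV !normr_nat (gtr0_norm s0).
  apply: (@le_lt_trans _ _ (2 * s / k%:R)).
    by rewrite ler_wpM2r ?invr_ge0 // ler_piMr // mulr_ge0 // ltW.
  by rewrite ltr_pdivrMr // [ltRHS]mulrC -ltr_pdivrMr.
(* Where [sigma i] changes, the image crosses a wall of the [i]-th grid; the pair records the wall's
   coordinate and index. The crossing costs [2 * r1], the distance to [y] another [r1]. *)
have /choice [pm Hpm] (i : 'I_d) : exists p : 'I_d * int,
    `|y ord0 p.1 - c ord0 p.1 - h * s * (i%:R + d%:R * p.2%:~R)| < 3 * r1.
  have [w [w' [/close hw /close hw' sw]]] := zsig i.
  have nidx : idx i (g (X w)) <> idx i (g (X w')).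
    by move=> e; case/eqP: sw; rewrite /sigma e.
  have [j jneq] : exists j, idx i (g (X w)) j <> idx i (g (X w')) j.
    apply: contrapT => H; apply: nidx; apply/ffunP => j.
    by apply: contrapT => ?; apply: H; exists j.
  rewrite !ffunE in jneq; have [m] := floor_neq_dist jneq.
  set a := g (X w) in hw *; set b := g (X w') in hw' *.
  move=> hm; exists (j, m) => /=.
  have ha := le_lt_trans (coord_le_norm _ j) hw; rewrite !mxE in ha.
  have hb := le_lt_trans (coord_le_norm _ j) hw'; rewrite !mxE in hb.
  have hab : `|a ord0 j - b ord0 j| < 2 * r1.
    by have := ler_distD (y ord0 j) (a ord0 j) (b ord0 j); rewrite (distrC (y ord0 j)); lra.
  have ham : `|a ord0 j - c ord0 j - h * s * (i%:R + d%:R * m%:~R)| <= `|a ord0 j - b ord0 j|.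
    move: hm; rewrite -(ler_pM2l h0) -{1 3}(gtr0_norm h0) -!normrM.
    rewrite (_ : h * ((a ord0 j - c ord0 j) / h - i%:R * s - m%:~R) =
       a ord0 j - c ord0 j - h * s * (i%:R + d%:R * m%:~R)); last first.
      have -> : h * s * (i%:R + d%:R * m%:~R) = h * s * i%:R + h * (d%:R * s) * m%:~R by ring.
      by rewrite ds; field; rewrite gt_eqF.
    rewrite (_ : h * ((a ord0 j - c ord0 j) / h - i%:R * s -
       ((b ord0 j - c ord0 j) / h - i%:R * s)) = a ord0 j - b ord0 j) //.
    by field; rewrite gt_eqF.
  have := ler_normD (y ord0 j - a ord0 j) (a ord0 j - c ord0 j - h * s * (i%:R + d%:R * m%:~R)).
  rewrite addrA (addrA (y ord0 j - a ord0 j)) subrK distrC in ha *; lra.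
(* Parallel walls of different grids are at least [h * s] apart, so the [d] walls near [y] use [d]
   different coordinates and meet in a vertex close to [y]. *)
have pinj : injective (fun i => (pm i).1).
  move=> i i' /= e; have h1 := Hpm i; have h2 := Hpm i'; rewrite -e in h2.
  set q := y ord0 _ - _ in h1 h2; move: h1 h2.
  set u := (pm i).2; set u' := (pm i').2 => h1 h2.
  have h3 : `|h * s * ((i%:R + d%:R * u%:~R) - (i'%:R + d%:R * u'%:~R))| < h * s * 1.
    have -> : h * s * ((i%:R + d%:R * u%:~R) - (i'%:R + d%:R * u'%:~R)) =
      (q - h * s * (i'%:R + d%:R * u'%:~R)) - (q - h * s * (i%:R + d%:R * u%:~R)) by ring.
    apply: le_lt_trans (ler_normB _ _) _; lra.
  rewrite normrM (gtr0_norm hs0) ltr_pM2l // in h3.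
  have h4 : `|(i%:Z + d%:Z * u) - (i'%:Z + d%:Z * u')| < 1.
    by rewrite -(ltr_int R) intr_norm intrB !intrD !intrM.
  by apply: val_inj; apply: residue_inj h4.
have [inv invK Kinv] := injF_bij pinj.
pose L j := (inv j)%:Z + d%:Z * (pm (inv j)).2.
have HL j : `|y ord0 j - c ord0 j - h * s * (L j)%:~R| < 3 * r1.
  by have := Hpm (inv j); rewrite Kinv intrD intrM.
have Lrange j : - N%:Z < L j < N%:Z.
  suff : `|(L j)%:~R| < N%:R :> R.
    by rewrite ltr_norml => /andP[l1 l2]; rewrite -!(ltr_int R) mulrNz l1 l2.
  apply: le_lt_trans hN; rewrite ler_pdivlMr //.
  have e1 : `|h * s * (L j)%:~R| <= M + 3.
    have := HL j; have := bM _ ty; have := coord_le_norm y j; have := coord_le_norm c j.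
    have := ler_normB (y ord0 j - c ord0 j) (y ord0 j - c ord0 j - h * s * (L j)%:~R).
    rewrite opprB addrCA subrr addr0; have := ler_normB (y ord0 j) (c ord0 j).
    have : 0 <= `|c| by []. lra.
  move: e1; rewrite !normrM (gtr0_norm h0) (gtr0_norm s0) => /(ler_wpM2l (ltW dR)).
  have dsq q : q * h = d%:R * (h * s * q).
    by rewrite -[LHS]mulr1 -[X in _ * X = _]ds; ring.
  by rewrite -dsq.
pose m := [ffun j => inord (absz (L j + N%:Z))] : {ffun 'I_d -> 'I_(N.*2.+1)}.
have vV : \row_j (h * s * ((m j)%:R - N%:R)) \in V by apply: map_f; rewrite mem_enum.
apply: (avoid _ (y - \row_j (h * s * ((m j)%:R - N%:R))) vV); last by rewrite subrK.
apply: norm_rV_lt => // j; rewrite !mxE ffunE.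
have [Nlt Neq] := absz_shift (Lrange j); rewrite inordK //.
have -> : (absz (L j + N%:Z))%:R = (L j)%:~R + N%:R :> R.
  by rewrite -[LHS]/((absz (L j + N%:Z) : int)%:~R) Neq intrD.
by rewrite addrK addrAC; have := HL j; lra.
Qed.
End DiskInterior.

(** * Smooth maps *)

Section SmoothCalculus.
Variable R : realType.

Lemma near_eq_differentiable (V W : normedModType R) (f g : V -> W) (x : V) :
  {near x, f =1 g} -> differentiable f x -> differentiable g x.
Proof.
move=> fg df.
have gE : g \o shift x = cst (g x) + 'd f x +o_ 0 id.
  apply/eqaddoP => e e0; have /eqaddoP /(_ e e0) := diff_locally df.
  have fg0 : \forall h \near (0 : V), f (h + x) = g (h + x).
    move: fg; rewrite (near_shift 0) /= subr0; apply: filterS => y ->.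
    by [].
  apply: filterS2 fg0 => h fgh; rewrite /= !fctE /= -fgh.
  by rewrite (nbhs_singleton fg).
have dg := diff_unique (diff_continuous df) gE.
apply/diff_locallyP; split; last by rewrite dg.
by rewrite dg; apply: diff_continuous.
Qed.

(** Bounding the order permits induction: [smooth_uptoS] peels off the innermost derivative, so the
    calculus rules never need a formula for iterated derivatives. *)
Definition smooth_upto (n : nat) (V W : normedModType R) (A : set V) (f : V -> W) :=
  forall (vs : seq V) (x : V), (size vs <= n)%N -> A x -> differentiable (iter_deriv vs f) x.

Section General.
Variables (V W : normedModType R) (A : set V).
Implicit Types (f g : V -> W) (n : nat).

Lemma smooth_onP f : smooth_on A f <-> forall n, smooth_upto n A f.
Proof. by split=> [H n vs x _|H vs x]; [exact: H|exact: (H (size vs))]. Qed.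

Lemma smooth_upto0 f : smooth_upto 0 A f <-> forall x, A x -> differentiable f x.
Proof. by split=> [H x Ax|H [|//] x _]; [exact: (H [::])|exact: H]. Qed.

Lemma smooth_uptoS n f : smooth_upto n.+1 A f <->
  (forall x, A x -> differentiable f x) /\
  forall v, smooth_upto n A (fun y => 'D_v f y).
Proof.
split=> [H|[H0 H] vs x].
  split=> [x Ax|v vs x vsn Ax]; first exact: (H [::]).
  by have := H (rcons vs v) x; rewrite size_rcons ltnS /iter_deriv foldr_rcons; apply.
case/lastP: vs => [|vs v] vsn Ax; first exact: H0.
by rewrite /iter_deriv foldr_rcons; apply: H => //; rewrite size_rcons in vsn.
Qed.

Lemma smooth_uptoW n f : smooth_upto n.+1 A f -> smooth_upto n A f.
Proof. by move=> H vs x vsn; apply: H; apply: leqW. Qed.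

Hypothesis oA : open A.

Lemma open_near (P : V -> Prop) x : A x -> (forall y, A y -> P y) -> \forall y \near x, P y.
Proof. by move=> Ax AP; apply: filterS AP _; apply: open_nbhs_nbhs. Qed.

Lemma smooth_upto_ext n f g : (forall x, A x -> f x = g x) ->
  smooth_upto n A f -> smooth_upto n A g.
Proof.
elim: n f g => [|n IH] f g fg.
  move=> /smooth_upto0 H; apply/smooth_upto0 => x Ax.
  by apply: near_eq_differentiable (H x Ax); apply: open_near.
move=> /smooth_uptoS [H0 H]; apply/smooth_uptoS; split=> [x Ax|v].
  by apply: near_eq_differentiable (H0 x Ax); apply: open_near.
by apply: IH (H v) => x Ax; apply: near_eq_derive; apply: open_near.
Qed.

Lemma smooth_upto_cst n (c : W) : smooth_upto n A (fun=> c).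
Proof.
elim: n c => [|n IH] c; first by apply/smooth_upto0 => x _; apply: differentiable_cst.
apply/smooth_uptoS; split=> [x _|v]; first exact: differentiable_cst.
by apply: smooth_upto_ext (IH 0) => x _; rewrite derive_cst.
Qed.

Lemma smooth_uptoD n f g : smooth_upto n A f -> smooth_upto n A g ->
  smooth_upto n A (fun x => f x + g x).
Proof.
elim: n f g => [|n IH] f g.
  move=> /smooth_upto0 Hf /smooth_upto0 Hg; apply/smooth_upto0 => x Ax.
  by apply: (differentiableD (Hf x Ax) (Hg x Ax)).
move=> /smooth_uptoS [Hf0 Hf] /smooth_uptoS [Hg0 Hg]; apply/smooth_uptoS; split=> [x Ax|v].
  by apply: (differentiableD (Hf0 x Ax) (Hg0 x Ax)).
apply: smooth_upto_ext (IH _ _ (Hf v) (Hg v)) => x Ax.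
by rewrite -deriveD //; apply: diff_derivable; [exact: Hf0|exact: Hg0].
Qed.

Lemma smooth_upto_sum n m (f : 'I_m -> V -> W) :
  (forall i, smooth_upto n A (f i)) -> smooth_upto n A (fun x => \sum_(i < m) f i x).
Proof.
elim: m f => [|m IH] f Hf.
  by apply: smooth_upto_ext (smooth_upto_cst (0 : W)) => x _; rewrite big_ord0.
apply: smooth_upto_ext (smooth_uptoD (Hf ord0) (IH (fun i => f (lift ord0 i)) _)) => //.
by move=> x _; rewrite big_ord_recl.
Qed.

End General.

Lemma smooth_upto_linear n (V W W' : normedModType R) (A : set V) (f : V -> W)
    (L : {linear W -> W'}) : open A -> continuous L ->
  smooth_upto n A f -> smooth_upto n A (fun x => L (f x)).
Proof.
move=> oA cL; elim: n f => [|n IH] f.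
  move=> /smooth_upto0 H; apply/smooth_upto0 => x Ax.
  by apply: differentiable_comp (H x Ax) _; apply: linear_differentiable.
move=> /smooth_uptoS [H0 H].
have dL x : A x -> differentiable (L \o f) x.
  by move=> Ax; apply: differentiable_comp (H0 x Ax) _; apply: linear_differentiable.
apply/smooth_uptoS; split=> [|v]; first exact: dL.
apply: smooth_upto_ext (IH _ (H v)) => // x Ax.
rewrite deriveE; last exact: H0.
rewrite [RHS]deriveE; last exact: dL.
have dLx : differentiable L (f x) by apply: linear_differentiable.
rewrite (diff_comp (H0 x Ax) dLx).
by rewrite /= diff_lin.
Qed.

Lemma smooth_upto_id n (V : normedModType R) (A : set V) : open A ->
  smooth_upto n A (id : V -> V).
Proof.
move=> oA; case: n => [|n]; first by apply/smooth_upto0 => x _.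
apply/smooth_uptoS; split=> [x _|v]; first by [].
by apply: smooth_upto_ext (smooth_upto_cst oA v) => // x _; rewrite derive_id.
Qed.

Section Scalar.
Variables (V : normedModType R) (A : set V).
Hypothesis oA : open A.
Implicit Types (f g : V -> R^o) (n : nat).

Lemma smooth_uptoM n f g : smooth_upto n A f -> smooth_upto n A g ->
  smooth_upto n A (fun x => f x * g x : R^o).
Proof.
elim: n f g => [|n IH] f g.
  move=> /smooth_upto0 Hf /smooth_upto0 Hg; apply/smooth_upto0 => x Ax.
  by apply: (differentiableM (Hf x Ax) (Hg x Ax)).
move=> Hf' Hg'; have [Hf0 Hf] := (smooth_uptoS _ _ _).1 Hf'.
have [Hg0 Hg] := (smooth_uptoS _ _ _).1 Hg'; apply/smooth_uptoS; split=> [x Ax|v].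
  by apply: (differentiableM (Hf0 x Ax) (Hg0 x Ax)).
apply: smooth_upto_ext (smooth_uptoD oA (IH _ _ (smooth_uptoW Hf') (Hg v))
  (IH _ _ (smooth_uptoW Hg') (Hf v))) => // x Ax.
by have := deriveM (diff_derivable (v := v) (Hf0 x Ax)) (diff_derivable (v := v) (Hg0 x Ax)).
Qed.

Lemma smooth_uptoV n f : (forall x, A x -> f x != 0) -> smooth_upto n A f ->
  smooth_upto n A (fun x => (f x)^-1 : R^o).
Proof.
move=> fn0; elim: n => [|n IH].
  move=> /smooth_upto0 Hf; apply/smooth_upto0 => x Ax.
  by apply: (differentiableV (Hf x Ax)); apply: fn0.
move=> Hf'; have [Hf0 Hf] := (smooth_uptoS _ _ _).1 Hf'.
have IHn := IH (smooth_uptoW Hf'); apply/smooth_uptoS; split=> [x Ax|v].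
  by apply: (differentiableV (Hf0 x Ax)); apply: fn0.
apply: smooth_upto_ext (smooth_uptoM (smooth_upto_cst oA (-1 : R^o))
  (smooth_uptoM (smooth_uptoM IHn IHn) (Hf v))) => // x Ax.
rewrite (deriveV (fn0 x Ax) (diff_derivable (v := v) (Hf0 x Ax))).
by rewrite mulN1r scaleNr -expr2 exprVn.
Qed.

(** The derivative is [D_v f] divided by twice the root, so order [n] for the root yields order
    [n.+1]. *)
Lemma smooth_upto_sqrt n f : (forall x, A x -> 0 < f x) -> smooth_upto n A f ->
  smooth_upto n A (fun x => Num.sqrt (f x) : R^o).
Proof.
move=> f0.
have dsqrt x : A x -> differentiable (@Num.sqrt R : R -> R) (f x).
  by move=> Ax; apply/derivable1_diffP; have [] := is_derive1_sqrt (f0 x Ax).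
have dcomp x : A x -> differentiable f x -> differentiable ((Num.sqrt : R -> R) \o f) x.
  by move=> Ax df; apply: differentiable_comp df (dsqrt x Ax).
elim: n => [|n IH].
  by move=> /smooth_upto0 Hf; apply/smooth_upto0 => x Ax; apply: dcomp => //; apply: Hf.
move=> Hf'; have [Hf0 Hf] := (smooth_uptoS _ _ _).1 Hf'.
have IHn := IH (smooth_uptoW Hf'); apply/smooth_uptoS; split=> [x Ax|v].
  by apply: dcomp => //; apply: Hf0.
have s2 : smooth_upto n A (fun x => 2 * Num.sqrt (f x) : R^o).
  exact: (smooth_uptoM (smooth_upto_cst oA (2 : R^o)) IHn).
apply: smooth_upto_ext (smooth_uptoM (Hf v) (smooth_uptoV _ s2)) => // x Ax; last first.
  by rewrite mulf_neq0 // gt_eqF // sqrtr_gt0 f0.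
rewrite [RHS]deriveE; last by apply: dcomp => //; apply: Hf0.
rewrite (diff_comp (Hf0 x Ax) (dsqrt x Ax)) /= -(deriveE v (Hf0 x Ax)).
rewrite (diff1E (dsqrt x Ax)) derive1E derive_sqrt ?f0 //.
Qed.

Lemma smooth_upto_coord n m (f : V -> 'rV[R]_m) i :
  smooth_upto n A f -> smooth_upto n A (fun x => f x ord0 i : R^o).
Proof.
have @L : {linear 'rV[R]_m -> R^o}.
  by exists (fun N : 'rV[R]_m => N ord0 i); do 2![eexists]; do ?[constructor];
     rewrite ?mxE // => ? *; rewrite ?mxE //; move=> ?; rewrite !mxE.
move=> Hf; apply: (smooth_upto_linear (L := L) oA) Hf.
exact: coord_continuous.
Qed.

Lemma smooth_upto_scalel n m (f : V -> R^o) (w : 'rV[R]_m) :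
  smooth_upto n A f -> smooth_upto n A (fun x => f x *: w).
Proof.
have lin : linear (fun a : R^o => a *: w) by move=> ? ? ?; rewrite scalerDl scalerA.
pose LM := GRing.isLinear.Build _ _ _ _ _ lin.
pose L : {linear R^o -> 'rV[R]_m} := HB.pack (fun a : R^o => a *: w) LM.
move=> Hf; apply: (smooth_upto_linear (L := L) oA) Hf.
exact: scalel_continuous.
Qed.

Lemma smooth_upto_rV n m (f : V -> 'rV[R]_m) :
  (forall i, smooth_upto n A (fun x => f x ord0 i : R^o)) -> smooth_upto n A f.
Proof.
move=> Hf; apply: smooth_upto_ext (smooth_upto_sum oA (fun j =>
  smooth_upto_scalel (delta_mx 0 j : 'rV[R]_m) (Hf j))) => // x _.
exact/esym/row_sum_delta.
Qed.

End Scalar.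

(** Expanding [D_v g] in the fixed basis leaves partial derivatives of [f] along constant
    directions, composed with [g], to which the induction hypothesis applies. *)
Lemma smooth_upto_comp n (V : normedModType R) (k : nat) (A : set V) (U : set 'rV[R]_k)
    (g : V -> 'rV[R]_k) (f : 'rV[R]_k -> R^o) : open A ->
  (forall x, A x -> U (g x)) -> smooth_upto n U f -> smooth_upto n A g ->
  smooth_upto n A (fun x => f (g x) : R^o).
Proof.
move=> oA gU; elim: n f => [|n IH] f.
  move=> /smooth_upto0 Hf /smooth_upto0 Hg; apply/smooth_upto0 => x Ax.
  by apply: differentiable_comp (Hg x Ax) (Hf _ (gU x Ax)).
move=> Hf' Hg'; have [Hf0 Hf] := (smooth_uptoS _ _ _).1 Hf'.
have [Hg0 Hg] := (smooth_uptoS _ _ _).1 Hg'.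
have dfg x : A x -> differentiable (f \o g) x.
  by move=> Ax; apply: differentiable_comp (Hg0 x Ax) (Hf0 _ (gU x Ax)).
apply/smooth_uptoS; split=> // v.
have S : smooth_upto n A (fun x => \sum_(j < k)
    ('D_v g x) ord0 j * 'D_(delta_mx 0 j : 'rV[R]_k) f (g x) : R^o).
  apply: smooth_upto_sum => // j; apply: smooth_uptoM => //.
    by apply: smooth_upto_coord.
  exact: (IH _ (Hf _) (smooth_uptoW Hg')).
apply: smooth_upto_ext S => // x Ax.
rewrite [RHS]deriveE; last exact: dfg.
have dfx := Hf0 _ (gU x Ax).
rewrite (diff_comp (Hg0 x Ax) dfx) /= -(deriveE v (Hg0 x Ax)).
rewrite [in RHS](row_sum_delta ('D_v g x)) linear_sum /=; apply: eq_bigr => j _.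
by rewrite linearZ /= (deriveE _ dfx).
Qed.

End SmoothCalculus.

(** * Rigidity of tilings *)

Lemma within_continuous_comp (X Y Z : topologicalType) (A : set X) (B : set Y)
    (h : X -> Y) (f : Y -> Z) : continuous h -> (forall x, A x -> B (h x)) ->
  {within B, continuous f} -> {within A, continuous (f \o h)}.
Proof.
move=> ch AB /subspace_continuousP cf; apply/subspace_continuousP => x Ax U Uf.
have H : nbhs (h x) [set y | B y -> U (f y)] := cf _ (AB _ Ax) U Uf.
have H2 : nbhs x (h @^-1` [set y | B y -> U (f y)]) := ch x _ H.
suff : nbhs x [set y | A y -> U (f (h y))] by [].
by apply: filterS H2 => y Hy Ay; apply: Hy; apply: AB.
Qed.

Lemma continuous_translate (R : realType) (V : normedModType R) (x : V) :
  continuous (fun y : V => y + x).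
Proof. by move=> y; apply: cvgD; [exact: cvg_id|exact: cvg_cst]. Qed.

Section Tilings.
Variables (R : realType) (d : nat).
Notation E := 'rV[R]_d.
Implicit Types (t : set E) (T : set (set E)) (x y u v w a b : E) (r e : R).

Lemma tr_setE t x y : tr_set t x y <-> t (y - x).
Proof.
by split=> [[z tz <-]|tyx]; [rewrite addrK|exists (y - x); rewrite ?subrK].
Qed.

Lemma tr_setD t x y : tr_set (tr_set t x) y = tr_set t (x + y).
Proof.
by apply/seteqP; split=> z; rewrite !tr_setE opprD addrA addrAC.
Qed.

Lemma tr_set0 t : tr_set t 0 = t.
Proof. by apply/seteqP; split=> z; rewrite tr_setE subr0. Qed.

Lemma tr_tilingE T x t : tr_tiling T x t <-> T (tr_set t (- x)).
Proof.
split=> [[s Ts <-]|Tt]; first by rewrite tr_setD subrr tr_set0.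
by exists (tr_set t (- x)) => //; rewrite tr_setD addNr tr_set0.
Qed.

Lemma tr_tilingD T x y : tr_tiling (tr_tiling T x) y = tr_tiling T (x + y).
Proof.
by apply/seteqP; split=> t; rewrite !tr_tilingE tr_setD -opprD addrC.
Qed.

Lemma tr_tiling0 T : tr_tiling T 0 = T.
Proof. by apply/seteqP; split=> t; rewrite tr_tilingE oppr0 tr_set0. Qed.

Lemma patchS T T' (A B : set E) : B `<=` A -> patch T A = patch T' A ->
  patch T B = patch T' B.
Proof.
move=> BA; suff sub T1 T2 : patch T1 A = patch T2 A -> patch T1 B `<=` patch T2 B.
  by move=> TA; apply/seteqP; split; apply: sub.
move=> TA t [Tt [y [ty By]]]; have : patch T1 A t.
  by split=> //; exists y; split=> //; apply: BA.
by rewrite TA => -[T2t _]; split=> //; exists y.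
Qed.

Lemma patch_tr T (A : set E) x :
  patch (tr_tiling T x) (tr_set A x) = tr_tiling (patch T A) x.
Proof.
apply/seteqP; split=> t.
  move=> [/tr_tilingE Tt [y [ty Ay]]]; apply/tr_tilingE; split=> //.
  exists (y - x); split; last by move/tr_setE: Ay.
  by apply/tr_setE; rewrite opprK subrK.
move=> /tr_tilingE [Tt [y [/tr_setE]]]; rewrite opprK => ty Ay.
split; first exact/tr_tilingE.
by exists (y + x); split=> //; apply/tr_setE; rewrite addrK.
Qed.

Lemma interior_tr_set t x y : interior t y -> interior (tr_set t x) (y + x).
Proof.
move=> /nbhs_ballP[e e0 et]; apply/nbhs_ballP; exists e => // z.
rewrite -ball_normE /= => zy; apply/tr_setE; apply: et; rewrite -ball_normE /=.
by rewrite opprB addrA.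
Qed.

Lemma homeomorphic_tr_set t x (B : set E) :
  homeomorphic t B -> homeomorphic (tr_set t x) B.
Proof.
move=> [f [g [fB [gA [gf [fg [cf cg]]]]]]].
exists (fun y => f (y - x)), (fun y => g y + x); split; [|split; [|split; [|split; [|split]]]].
- by move=> y /tr_setE; apply: fB.
- by move=> y By; apply/tr_setE; rewrite addrK; apply: gA.
- by move=> y /tr_setE ty; rewrite gf // subrK.
- by move=> y By; rewrite addrK fg.
- apply: (@within_continuous_comp _ _ _ (tr_set t x) t (fun y => y - x) f) => //.
    exact: continuous_translate.
  by move=> y /tr_setE.
- move/subspace_continuousP: cg => cg; apply/subspace_continuousP => y By.
  by apply: cvgD; [exact: cg|exact: cvg_cst].
Qed.

Lemma is_tiling_tr T x : is_tiling T -> is_tiling (tr_tiling T x).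
Proof.
move=> [[n [tau Htau]] [hom [cov dis]]]; split; [|split; [|split]].
- exists n, tau => t /tr_tilingE /Htau [i [y ty]]; exists i, (y + x).
  by rewrite -tr_setD -ty tr_setD addNr tr_set0.
- move=> t /tr_tilingE /hom /(homeomorphic_tr_set x).
  by rewrite tr_setD addNr tr_set0.
- move=> y; have [t [Tt ty]] := cov (y - x); exists (tr_set t x); split.
    by exists t.
  exact/tr_setE.
move=> t t' /tr_tilingE Tt /tr_tilingE Tt' tt'.
have H := dis _ _ Tt Tt'; apply/seteqP; split=> // y [ty t'y].
suff : (interior (tr_set t (- x)) `&` interior (tr_set t' (- x))) (y - x).
  rewrite H // => /(congr1 (fun s => tr_set s x)).
  by rewrite !tr_setD addNr !tr_set0.
by split; [exact: (interior_tr_set _ ty)|exact: (interior_tr_set _ t'y)].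
Qed.

(** Finitely many prototiles make the inner radius uniform; a prototile without a tile in [T] gets
    the filler 1. *)
Lemma is_tiling_ball T : (0 < d)%N -> is_tiling T ->
  exists2 e : R, 0 < e & forall t, T t -> exists c, eball c e `<=` t.
Proof.
move=> d0 [[n [tau Htau]] [hom _]].
have /choice [e He] (i : 'I_n) : exists e : R, 0 < e /\
    ((exists x, T (tr_set (tau i) x)) -> exists c, eball c e `<=` tau i).
  have [[x Tx]|no] := pselect (exists x, T (tr_set (tau i) x)); last by exists 1.
  have [y] := homeomorphic_disk_interior d0 (hom _ Tx).
  move=> /nbhs_eballP [e e0 He]; exists e; split=> // _; exists (y - x) => z zy.
  have /He : eball y e (z + x) by rewrite /eball /= in zy *; rewrite opprB addrA in zy.
  by move/tr_setE; rewrite addrK.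
exists (\big[Num.min/1]_(i < n) e i).
  by apply: lt_bigmin => // i _; case: (He i).
move=> t Tt; have [i [x tx]] := Htau _ Tt.
have [_ [|c Hc]] := He i; first by exists x; rewrite -tx.
exists (c + x) => y yc; rewrite tx; apply/tr_setE; apply: Hc.
rewrite /eball /= -addrA -opprD (addrC x); apply: lt_le_trans yc _.
by apply: bigmin_le_cond.
Qed.

(** Otherwise the multiples of [w] would carry a point of [t] out of every bounded set. *)
Lemma compact_tr_set_fixed t w : compact t -> t !=set0 -> tr_set t w = t -> w = 0.
Proof.
move=> /compact_bounded [M [_ bM]] [y ty] tw.
have tk k : t (y + w *+ k).
  elim: k => [|k IH]; first by rewrite addr0.
  by rewrite -tw; apply/tr_setE; rewrite mulrSr addrA addrK.
apply/eqP; rewrite -normr_eq0; apply/negPn/negP => w0.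
have {}w0 : 0 < `|w| by rewrite lt_neqAle eq_sym w0 normr_ge0.
pose M1 := M + 1 + `|y|; pose k := (Num.truncn (M1 / `|w|)).+1.
have : M1 / `|w| < k%:R by apply: truncnS_gt.
rewrite ltr_pdivrMr // mulr_natl -normrMn; apply/negP; rewrite -leNgt /M1.
have -> : w *+ k = (y + w *+ k) - y by rewrite addrAC subrr add0r.
apply: le_trans (ler_normB _ _) _; rewrite lerD2r; apply: bM (tk k).
by rewrite ltrDl.
Qed.

Definition rigid e T := forall u v r, 0 <= r -> enorm (u - v) < e ->
  patch (tr_tiling T u) (@cball R d r) = patch (tr_tiling T v) (@cball R d r) -> u = v.

Lemma rigid_tr e T x : rigid e T -> rigid e (tr_tiling T x).
Proof.
move=> rT u v r r0 uv; rewrite !tr_tilingD => /(rT _ _ _ r0) H.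
by apply: (addrI x); apply: H; rewrite opprD addrACA subrr add0r.
Qed.

(** A tile [t] containing [- u] decides: [t] and its translate by [w = u - v] both belong to [T],
    and [w] is shorter than the inner radius, so their interiors meet and they coincide. Compactness
    then forces [w = 0]. *)
Lemma is_tiling_rigid T : (0 < d)%N -> is_tiling T -> exists2 e, 0 < e & rigid e T.
Proof.
move=> d0 hT; have [e e0 He] := is_tiling_ball d0 hT; exists e => //.
case: hT => _ [hom [cov dis]] u v r r0 uv pE.
have [t [Tt t0]] := cov (0 - u).
have : patch (tr_tiling T u) (@cball R d r) (tr_set t u).
  split; first by exists t.
  by exists 0; split; [exact/tr_setE|rewrite /cball /= enorm0].
rewrite pE => -[/tr_tilingE]; rewrite tr_setD; set w := u - v => Tw _.
apply/eqP; rewrite -subr_eq0; apply/eqP.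
have ct := homeomorphic_disk_compact (hom _ Tt).
apply: (compact_tr_set_fixed ct); first by exists (0 - u).
apply: contrapT => /nesym ne; have [c Hc] := He _ Tt.
have := dis _ _ Tt Tw ne; apply/eqP/set0P; exists c; split.
  by apply/nbhs_eballP; exists e.
rewrite -(subrK w c); apply: (@interior_tr_set t w (c - w)).
suff : nbhs (c - w) (eball c e) by apply: filterS.
apply: open_nbhs_nbhs; split; first exact: open_eball.
by rewrite /eball /= addrAC subrr add0r enormN.
Qed.

(** By rigidity [u] is the only admissible vector shorter than [e / 2]. This produces the gap in the
    values of [dr r]. *)
Lemma dr_patch e T T' u r : rigid e T -> 0 <= r -> enorm u < e / 2 ->
  patch (tr_tiling T u) (@cball R d r) = patch T' (@cball R d r) ->
  dr r T T' = (enorm u)%:E.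
Proof.
move=> rT r0 ue pE; rewrite /dr.
set S := (X in ereal_inf [set _ | _ in X]).
have SE : S = [set x : R | enorm u < x].
  apply/seteqP; split=> x; rewrite /S /=.
    move=> [x0 [v [vx pv]]].
    have [xe|ex] := ltP x (e / 2); last exact: lt_le_trans ue ex.
    suff -> : u = v by [].
    apply: (rT _ _ r) => //; last by rewrite pE pv.
    rewrite (splitr e) (le_lt_trans (enormD _ _)) // enormN ltrD //.
    exact: lt_trans vx xe.
  by move=> ux; split; [exact: le_lt_trans (enorm_ge0 _) ux|exists u].
rewrite SE; apply/eqP; rewrite eq_le; apply/andP; split.
  apply/lee_addgt0Pr => x x0; apply: ereal_inf_lbound.
  by exists (enorm u + x) => //=; rewrite ltrDl.
by apply/ereal_infP => _ [x /= ux <-]; rewrite lee_fin ltW.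
Qed.

Lemma dr_translate e T a b r : rigid e T -> 0 <= r -> enorm (b - a) < e / 2 ->
  dr r (tr_tiling T a) (tr_tiling T b) = (enorm (b - a))%:E.
Proof.
move=> rT r0 ab; apply: (@dr_patch e _ _ (b - a)) => //; first exact: rigid_tr.
by rewrite tr_tilingD addrCA subrr addr0.
Qed.

Lemma dr_lt e T T' r : (dr r T T' < e%:E)%E -> exists2 u, enorm u < e &
  patch (tr_tiling T u) (@cball R d r) = patch T' (@cball R d r).
Proof.
move=> /ereal_inf_lt [_ [x /= [x0 [u [ux pE]]] <-]]; rewrite lte_fin => xe.
by exists u => //; apply: lt_trans ux xe.
Qed.

Lemma hull_tr T T1 x : hull T T1 -> hull T (tr_tiling T1 x).
Proof.
move=> [til [tiles app]]; split; [exact: is_tiling_tr|split].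
  move=> t /tr_tilingE /tiles [s [y [Ts sE]]]; exists s, (y + x); split=> //.
  by rewrite -tr_setD -sE tr_setD addNr tr_set0.
(* The cap [1 / sqrt 2] rules out the extra element in [tdist]; the other bound makes the common
   patch large enough to cover the ball of radius [2 / e] after a shift by [x]. *)
move=> e e0; set e1 := Num.min (1 / Num.sqrt 2) ((2 / e + enorm x)^-1).
have s0 : 0 < 1 / Num.sqrt 2 :> R by rewrite divr_gt0 // sqrtr_gt0.
have ex0 : 0 < 2 / e + enorm x by rewrite ltr_pwDl ?divr_gt0 ?enorm_ge0.
have e10 : 0 < e1 by rewrite lt_min s0 invr_gt0.
have [z] := app _ e10; rewrite /tdist => /inf_lt [].
  by exists (1 / Num.sqrt 2); right.
move=> e2 [[e20 [u [v [ue [ve pE]]]]]|->]; last by rewrite lt_min ltxx.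
rewrite lt_min => /andP[_ e2lt].
have e2V : 2 / e + enorm x < e2^-1.
  by rewrite -[ltLHS]invrK ltf_pV2 // posrE invr_gt0.
have e2e : e2 < e / 2.
  rewrite -[ltRHS]invrK -ltf_pV2 ?posrE ?invr_gt0 ?divr_gt0 // invrK invf_div.
  by apply: le_lt_trans e2V; rewrite lerDl enorm_ge0.
exists (z + x); apply: (@le_lt_trans _ _ (e / 2)); last first.
  by rewrite ltr_pdivrMr // ltr_pMr // ltr1n.
apply: ge_inf; first by exists 0 => y [[y0 _]|->]; exact: ltW.
left; split; first by rewrite divr_gt0.
exists u, v; split; first exact: lt_trans ue e2e; split; first exact: lt_trans ve e2e.
have -> : tr_tiling (tr_tiling T1 x) u = tr_tiling (tr_tiling T1 u) x.
  by rewrite !tr_tilingD addrC.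
have -> : tr_tiling (tr_tiling T (z + x)) v = tr_tiling (tr_tiling (tr_tiling T z) v) x.
  by rewrite !tr_tilingD -addrA (addrC x).
apply: (@patchS _ _ (tr_set (eball 0 e2^-1) x)).
  move=> y; rewrite /eball /= subr0 => yy; apply/tr_setE; rewrite /eball /= subr0.
  apply: le_lt_trans (enormD _ _) _; rewrite enormN; apply: lt_trans e2V.
  by rewrite ltrD2r -invf_div.
by rewrite !patch_tr pE.
Qed.

End Tilings.

(** * Smoothness of compositions and of the Euclidean norm away from 0 *)

Section SmoothEuclidean.
Variable R : realType.

Lemma smooth_on_sub (V W : normedModType R) (A B : set V) (f : V -> W) :
  B `<=` A -> smooth_on A f -> smooth_on B f.
Proof. by move=> BA Hf vs x /BA; apply: Hf. Qed.

Lemma smooth_on_ext (V W : normedModType R) (A : set V) (f g : V -> W) :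
  open A -> (forall x, A x -> f x = g x) -> smooth_on A f -> smooth_on A g.
Proof.
by move=> oA fg /smooth_onP H; apply/smooth_onP => n; apply: smooth_upto_ext (H n).
Qed.

Lemma smooth_on_comp (V : normedModType R) k m (A : set V) (U : set 'rV[R]_k)
    (g : V -> 'rV[R]_k) (f : 'rV[R]_k -> 'rV[R]_m) : open A -> open U ->
  (forall x, A x -> U (g x)) -> smooth_on U f -> smooth_on A g ->
  smooth_on A (fun x => f (g x)).
Proof.
move=> oA oU gU /smooth_onP Hf /smooth_onP Hg; apply/smooth_onP => n.
apply: smooth_upto_rV => // i.
apply: (@smooth_upto_comp _ n _ _ A U g (fun y => f y ord0 i)) => //.
exact: smooth_upto_coord.
Qed.

Lemma smooth_on_enorm (V : normedModType R) m (A : set V) (f : V -> 'rV[R]_m) c :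
  open A -> (forall x, A x -> f x <> c) -> smooth_on A f ->
  smooth_on A (fun x => enorm (f x - c) : R^o).
Proof.
move=> oA fc /smooth_onP Hf; apply/smooth_onP => n.
apply: smooth_upto_sqrt => //.
  move=> x Ax; rewrite lt_neqAle sum_sqr_ge0 andbT eq_sym; apply/negP => /eqP s0.
  by apply: (fc x Ax); apply/subr0_eq/enorm_eq0; rewrite /enorm s0 sqrtr0.
apply: smooth_upto_sum => // i.
have H : smooth_upto n A (fun x => (f x - c) ord0 i : R^o).
  by apply: smooth_upto_coord => //; apply: smooth_uptoD => //; exact: smooth_upto_cst.
by apply: smooth_upto_ext (smooth_uptoM oA H H) => // x _; rewrite expr2.
Qed.

End SmoothEuclidean.

(** * Finite spanning families and Gram matrices *)

Section LinearAlgebra.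

(** Take [M] of maximal rank among matrices with rows in [D]. Rows from [D] itself matter, since
    smooth products are available only with vectors of [D]. *)
Lemma finite_row_span (F : fieldType) d (D : set 'rV[F]_d) :
  exists n (M : 'M[F]_(n, d)), (forall i, D (row i M)) /\
    forall v, D v -> (v <= M)%MS.
Proof.
pose P r := `[< exists n (M : 'M[F]_(n, d)), (forall i, D (row i M)) /\ \rank M = r >].
have exP : exists r, P r.
  by exists 0%N; apply/asboolP; exists 0%N, 0; split; [case|rewrite mxrank0].
have ubP r : P r -> (r <= d)%N.
  by move=> /asboolP[n [M [_ <-]]]; apply: rank_leq_col.
case: (ex_maxnP exP ubP) => r /asboolP[n [M [DM rM]]] max.
exists n, M; split=> // v Dv.
have sMv : (M <= col_mx M v)%MS by rewrite -addsmxE addsmxSl.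
have /max : P (\rank (col_mx M v)).
  apply/asboolP; exists (n + 1)%N, (col_mx M v); split=> // i.
  by case: (split_ordP i) => j ->; [rewrite rowKu|rewrite rowKd row_id].
rewrite -rM => le; have : \rank M == \rank (col_mx M v).
  by rewrite eqn_leq le mxrankS.
rewrite (mxrank_leqif_sup sMv) => /(submx_trans _); apply.
by rewrite -addsmxE addsmxSr.
Qed.

Lemma row_dot_self_eq0 (R : realFieldType) d (x : 'rV[R]_d) : x *m x^T = 0 -> x = 0.
Proof.
move=> /matrixP /(_ 0 0); rewrite !mxE => /eqP.
under eq_bigr do rewrite mxE -expr2.
rewrite psumr_eq0; last by move=> i _; apply: sqr_ge0.
move=> /allP H; apply/rowP => i; have := H i (mem_index_enum i).
by rewrite /= sqrf_eq0 mxE => /eqP.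
Qed.

(** The Gram matrix may be singular. Its pseudo-inverse recovers the coefficients of [v] up to a
    combination of rows of square norm 0, which vanishes over an ordered field. *)
Lemma gram_reconstruct (R : realFieldType) n d (M : 'M[R]_(n, d)) :
  exists Q : 'M[R]_(n, d), forall v : 'rV_d, (v <= M)%MS -> v *m M^T *m Q = v.
Proof.
exists (pinvmx (M *m M^T) *m M) => v /submxP [c ->].
set G := M *m M^T; rewrite mulmxA -(mulmxA c M) -/G.
pose c' := c *m G *m pinvmx G.
have e1 : c' *m G = c *m G by rewrite /c' mulmxKpV // submxMl.
apply/eqP; rewrite -subr_eq0 -mulmxBl; apply/eqP; set x := (_ - c) *m M.
have : x *m x^T = 0.
  rewrite /x trmx_mul mulmxA -(mulmxA _ M) -/G mulmxBl e1 subrr mul0mx //.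
exact: row_dot_self_eq0.
Qed.

End LinearAlgebra.

Lemma enormB_sqr (R : realType) n (x y : 'rV[R]_n) :
  enorm (x - y) ^+ 2 = enorm x ^+ 2 - 2 * (\sum_i x ord0 i * y ord0 i) + enorm y ^+ 2.
Proof.
rewrite !enorm_sqr mulr_sumr -sumrB -big_split /=; apply: eq_bigr => i _.
by rewrite !mxE; ring.
Qed.

(* The polarization [2 <u, a - b> = |u - b|^2 - |u - a|^2 + |a|^2 - |b|^2]
   makes [<u, .>] smooth on the span of the differences of nonzero values of [u];
   the nonzero values lie in a single coset of this span, so either [u] stays in
   the span and is recovered from these products, or it vanishes near [t0]. *)
Lemma smooth_of_smooth_distances (R : realType) m d (u : 'rV[R]_m -> 'rV[R]_d)
    (N : set 'rV[R]_m) (t0 : 'rV[R]_m) :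
  nbhs t0 N ->
  (forall e : R, 0 < e -> \forall t \near t0, `|u t| < e) ->
  (forall t1, N t1 -> u t1 <> 0 -> exists W, [/\ open W, W t0 &
     smooth_on W (fun t => enorm (u t - u t1) : R^o)]) ->
  exists2 W, open W /\ W t0 & W `<=` N /\ smooth_on W u.
Proof.
move=> Nt0 u0 Hs.
pose D := [set v : 'rV[R]_d | exists t1 t2,
  [/\ N t1, N t2, u t1 <> 0, u t2 <> 0 & v = u t1 - u t2]].
have [n [M [DM MD]]] := finite_row_span D.
have HD v : D v -> \forall t \near t0, exists W, [/\ open W, W t &
    smooth_on W (fun t => (u t *m v^T) ord0 ord0 : R^o)].
  move=> [t1 [t2 [N1 N2 u1 u2 ->]]].
  have [W1 [oW1 W1t sW1]] := Hs _ N1 u1; have [W2 [oW2 W2t sW2]] := Hs _ N2 u2.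
  have oW : open (W1 `&` W2) by apply: openI.
  have sW : smooth_on (W1 `&` W2) (fun t => (u t *m (u t1 - u t2)^T) ord0 ord0 : R^o).
    have {}sW1 : smooth_on (W1 `&` W2) (fun t => enorm (u t - u t1) : R^o).
      by apply: smooth_on_sub sW1; apply: subIsetl.
    have {}sW2 : smooth_on (W1 `&` W2) (fun t => enorm (u t - u t2) : R^o).
      by apply: smooth_on_sub sW2; apply: subIsetr.
    apply/smooth_onP => k; move/smooth_onP: sW1 => /(_ k) sW1.
    move/smooth_onP: sW2 => /(_ k) sW2.
    pose c : R^o := enorm (u t1) ^+ 2 - enorm (u t2) ^+ 2.
    apply: smooth_upto_ext (smooth_uptoM oW (smooth_upto_cst oW (2^-1 : R^o))
      (smooth_uptoD oW (smooth_uptoM oW sW2 sW2) (smooth_uptoD oW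
        (smooth_uptoM oW (smooth_upto_cst oW (-1 : R^o)) (smooth_uptoM oW sW1 sW1))
        (smooth_upto_cst oW c)))) => // t _.
    have -> : (u t *m (u t1 - u t2)^T) ord0 ord0 = \sum_i u t ord0 i * u t1 ord0 i
        - \sum_i u t ord0 i * u t2 ord0 i.
      by rewrite mxE -sumrB; apply: eq_bigr => i _; rewrite !mxE mulrBr.
    by rewrite /c -!expr2 !enormB_sqr; field.
  by near=> t; exists (W1 `&` W2); split=> //; near: t; apply: open_nbhs_nbhs.
have nW : \forall t \near t0, N t /\ forall i, exists W, [/\ open W, W t &
    smooth_on W (fun t => (u t *m (row i M)^T) ord0 ord0 : R^o)].
  near=> t; split; first by near: t.
  by near: t; apply: filter_forall => i; apply: HD.
have [del del0 Hdel] := (nbhs_eballP _ _).1 nW.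
pose W := eball t0 del; have oW : open W by apply: open_eball.
have Wt0 : W t0 by apply: eball_center.
have WN : W `<=` N by move=> t /Hdel [].
have sMi i : smooth_on W (fun t => (u t *m (row i M)^T) ord0 ord0 : R^o).
  by move=> vs x /Hdel [_ /(_ i) [W' [_ W'x]]]; apply.
have sM : smooth_on W (fun t => u t *m M^T).
  apply/smooth_onP => k; apply: smooth_upto_rV => // i.
  have /smooth_onP /(_ k) := sMi i; apply: smooth_upto_ext => // t _.
  by rewrite !mxE; apply: eq_bigr => j _; rewrite !mxE.
have [inM|] := pselect (forall t, N t -> (u t <= M)%MS).
  exists W => //; split=> //; have [Q HQ] := gram_reconstruct M.
  apply/smooth_onP => k.
  apply: smooth_upto_rV => // i.
  apply: smooth_upto_ext (smooth_upto_sum oW (fun j => smooth_uptoM oW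
    (smooth_upto_coord oW j ((smooth_onP _ _).1 sM k)) (smooth_upto_cst oW (Q j i : R^o)))) => //.
  by move=> t /WN /inM /HQ {2}<-; rewrite [RHS]mxE.
move=> /existsNP [t1 /not_implyP [N1 /negP uM]].
have u1 : u t1 <> 0 by move=> u10; rewrite u10 sub0mx in uM.
have uC t : N t -> u t <> 0 -> u t *m cokermx M = u t1 *m cokermx M.
  move=> Nt ut; apply/eqP; rewrite -subr_eq0 -mulmxBl -submxE; apply: MD.
  by exists t, t1.
have [j bj] : exists j, (u t1 *m cokermx M) ord0 j <> 0.
  apply: contrapT => H; move: uM; rewrite submxE => /eqP; apply.
  by apply/rowP => j; rewrite [RHS]mxE; apply: contrapT => ?; apply: H; exists j.
set b := (u t1 *m cokermx M) ord0 j in bj.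
(* [K] bounds, for the sup norm, the functional taking [x] to coordinate [j] of [x *m cokermx M].
   Nonzero values of [u] on [N] all give [b], hence have norm at least [|b| / K]; the summand 1
   keeps [K] positive. *)
pose K := \sum_i `|cokermx M i j| + 1.
have K0 : 0 < K by rewrite ltr_wpDl // sumr_ge0.
have b0 : 0 < `|b| by rewrite normr_gt0; apply/eqP.
have nz : \forall t \near t0, N t /\ u t = 0.
  have bK : 0 < `|b| / K by rewrite divr_gt0.
  near=> t; split; first by near: t.
  apply: contrapT => ut; have Nt : N t by near: t.
  have ub : `|u t| < `|b| / K by near: t; apply: u0.
  have : (u t *m cokermx M) ord0 j = b by rewrite uC.
  rewrite mxE => eb; move: ub; rewrite ltr_pdivlMr // -eb; apply/negP; rewrite -leNgt.
  apply: le_trans (ler_norm_sum _ _ _) _; rewrite /K mulrDr mulr_sumr.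
  rewrite ler_wpDr ?mulr1 //; apply: ler_sum => i _; rewrite normrM.
  by rewrite ler_wpM2r // coord_le_norm.
have [del' del'0 Hdel'] := (nbhs_eballP _ _).1 nz.
exists (eball t0 del'); first by split; [exact: open_eball|exact: eball_center].
split; first by move=> t /Hdel' [].
apply: (@smooth_on_ext _ _ _ _ (fun=> 0)); first exact: open_eball.
  by move=> t /Hdel' [].
by apply/smooth_onP => k; apply: smooth_upto_cst; apply: open_eball.
Unshelve. all: by end_near. Qed.

(** * Plots *)

Section Plots.
Variables (R : realType) (d : nat).
Notation E := 'rV[R]_d.
Implicit Types (T : set (set E)).

Lemma cballS (r s : R) : r <= s -> @cball R d r `<=` @cball R d s.
Proof. by move=> rs x xr; apply: le_trans xr rs. Qed.

Lemma is_tiling_eq_patch T1 T2 : is_tiling T1 -> is_tiling T2 ->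
  (forall r : R, 1 <= r -> patch T1 (@cball R d r) = patch T2 (@cball R d r)) -> T1 = T2.
Proof.
suff sub T T' : is_tiling T ->
    (forall r : R, 1 <= r -> patch T (@cball R d r) = patch T' (@cball R d r)) -> T `<=` T'.
  by move=> h1 h2 H; apply/seteqP; split; apply: sub => // r /H.
move=> [_ [hom _]] H t Tt; have [f [g [_ [gA _]]]] := hom _ Tt.
have t0 : t (g 0) by apply: gA; rewrite /cball /= enorm0.
have /H : 1 <= 1 + enorm (g 0) by rewrite lerDl enorm_ge0.
move=> /seteqP [/(_ t) P _]; case: P => //; split=> //; exists (g 0); split=> //.
by rewrite /cball /= lerDr.
Qed.

Lemma rigid_tr_inj e T u v : rigid e T -> enorm (u - v) < e ->
  tr_tiling T u = tr_tiling T v -> u = v.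
Proof. by move=> rT uv E; apply: (rT _ _ 0) => //; rewrite E. Qed.

(* On a connected neighbourhood of [t0] where [dr 1] is small, [dr r] takes values
   in a small interval or above [e / 2], hence stays small and all radii share
   the same translation vector. *)
Lemma dr_continuous_orbit e m (p : 'rV[R]_m -> set (set E)) (t0 : 'rV[R]_m) (del : R) :
  0 < e -> rigid e (p t0) -> 0 < del ->
  (forall t, eball t0 del t -> is_tiling (p t)) ->
  (forall r : R, 0 < r ->
     {within eball t0 del, continuous (fun t => dr r (p t0) (p t))}) ->
  exists2 del1 : R, 0 < del1 & eball t0 del1 `<=` eball t0 del /\
    forall t, eball t0 del1 t -> exists2 u, enorm u < e / 4 &
      p t = tr_tiling (p t0) u.
Proof.
move=> e0 rT del0 til cdr.
have cphi r t : 0 < r -> eball t0 del t -> {for t, continuous (fun t => dr r (p t0) (p t))}.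
  move=> r0 tdel; have := cdr r r0.
  rewrite continuous_open_subspace; last exact: open_eball.
  by apply; rewrite inE.
have e4 : e / 4 < e / 2 by lra.
have e20 : 0 < e / 2 by lra.
have [del1 del10 H1] : exists2 del1 : R, 0 < del1 & eball t0 del1 `<=`
    eball t0 del `&` [set t | (dr 1 (p t0) (p t) < (e / 4)%:E)%E].
  apply/nbhs_eballP; apply: filterI.
    by apply/nbhs_eballP; exists del.
  suff /(cphi 1 t0 ltr01 (eball_center _ del0)) :
    nbhs (dr 1 (p t0) (p t0)) [set y | (y < (e / 4)%:E)%E] by [].
  apply: open_nbhs_nbhs; split; first exact: open_ereal_lt_ereal.
  rewrite /= (@dr_patch _ _ e _ _ 0) ?enorm0 ?tr_tiling0 ?lte_fin //; lra.
have sub1 : eball t0 del1 `<=` eball t0 del by move=> t /H1 [].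
exists del1 => //; split=> // t t1.
(* Restricted to radius 1, the vector [u] computes [dr 1], already known to be below [e / 4]. So
   [dr r] takes no value in [[e / 4, e / 2)]. *)
have gap r s : 1 <= r -> eball t0 del1 s -> (dr r (p t0) (p s) < (e / 2)%:E)%E ->
    exists2 u, enorm u < e / 4 &
      patch (tr_tiling (p t0) u) (@cball R d r) = patch (p s) (@cball R d r).
  move=> r1 sdel /dr_lt [u ue pE]; exists u => //.
  have [_] := H1 _ sdel; rewrite /= (@dr_patch _ _ e _ _ u) ?lte_fin //.
  by apply: patchS pE; apply: cballS.
have main r : 1 <= r -> (dr r (p t0) (p t) < (e / 2)%:E)%E.
  move=> r1; have r0 : 0 < r by apply: lt_le_trans r1.
  pose seg := (fun s : R => t0 + s *: (t - t0)) @` `[0, 1].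
  have segball x : seg x -> eball t0 del1 x.
    move=> [s /=]; rewrite in_itv /= => /andP[s0 s1] <-.
    rewrite /eball /= addrAC subrr add0r enormZ ger0_norm //.
    by apply: le_lt_trans t1; rewrite ler_piMl // enorm_ge0.
  have cseg : connected seg.
    apply: connected_continuous_connected; first exact: segment_connected.
    apply: continuous_subspaceT => s; apply: cvgD; first exact: cvg_cst.
    exact: scalel_continuous.
  have t0seg : seg t0 by exists 0; [rewrite /= in_itv /= lexx ler01|rewrite scale0r addr0].
  have tseg : seg t.
    by exists 1; [rewrite /= in_itv /= lexx ler01|rewrite scale1r addrC subrK].
  pose B := seg `&` [set x | (dr r (p t0) (p x) < (e / 2)%:E)%E].
  suff : B = seg by move=> Bs; have : seg t by []; rewrite -Bs => -[].
  apply: cseg.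
  - exists t0; split=> //=; rewrite (@dr_patch _ _ e _ _ 0) ?enorm0 ?tr_tiling0 ?lte_fin //.
    exact: ltW.
  - exists (eball t0 del `&` (fun x => dr r (p t0) (p x)) @^-1` [set y | (y < (e / 2)%:E)%E]).
      have := (@continuous_inP _ _ (eball t0 del) (fun x => dr r (p t0) (p x))
        (@open_eball _ _ _ _)).1.
      apply; last exact: open_ereal_lt_ereal.
      by move=> x; rewrite inE; apply: cphi.
    apply/seteqP; split=> x [sx Hx]; split=> //; last by case: Hx.
    by split=> //; apply/sub1/segball.
  (* By the gap, [dr r < e / 2] amounts to [dr r <= e / 4] on the segment, a closed condition. *)
  - exists (~` (eball t0 del `&` (fun x => dr r (p t0) (p x)) @^-1` [set y | ((e / 4)%:E < y)%E])).
      apply: open_closedC.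
      have := (@continuous_inP _ _ (eball t0 del) (fun x => dr r (p t0) (p x))
        (@open_eball _ _ _ _)).1.
      apply; last exact: open_ereal_gt_ereal.
      by move=> x; rewrite inE; apply: cphi.
    apply/seteqP; split=> x [sx Hx]; split=> //.
      move=> [_ /=]; have [u ue pE] := gap r x r1 (segball _ sx) Hx.
      rewrite (@dr_patch _ _ e _ _ u _ rT (ltW r0)) //; last exact: lt_trans e4.
      by rewrite lte_fin; lra.
    rewrite /=; apply: le_lt_trans (_ : ((e / 4)%:E < _)%E); last by rewrite lte_fin.
    rewrite leNgt; apply/negP => H; apply: Hx; split=> //.
    by apply/sub1/segball.
have [u ue pE] := gap 1 t (lexx _) t1 (main 1 (lexx _)); exists u => //.
apply: is_tiling_eq_patch; [exact/til/sub1|apply/is_tiling_tr/til/eball_center => //|].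
(* A priori [v] depends on [r]; but [u] and [v] are both shorter than [e / 4] and agree at radius 1,
   so rigidity identifies them. *)
move=> r r1; have [v ve pEv] := gap r t r1 t1 (main r r1).
suff -> : u = v by rewrite pEv.
apply: (rT _ _ 1) => //.
  apply: le_lt_trans (enormD _ _) _; rewrite enormN; lra.
by rewrite pE; apply/esym; apply: patchS pEv; apply: cballS.
Qed.
End Plots.

(** * Comparison of the two diffeologies *)

Section Diffeologies.
Variables (R : realType) (d : nat).
Notation E := 'rV[R]_d.
Implicit Types (T : set (set E)) (p : param R (set (set E))).

Definition locally_translates T : set (param R (set (set E))) :=
  [set p | is_param (hull T) p /\ forall t0, @pdom _ _ p t0 ->
    exists (W : set 'rV[R]_(pdim p)) T1 (f : 'rV[R]_(pdim p) -> E),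
      [/\ open W /\ W t0, W `<=` @pdom _ _ p, hull T T1, smooth_on W f &
          forall t, W t -> @pmap _ _ p t = tr_tiling T1 (f t)]].

Lemma smooth_on_continuous m n (W : set 'rV[R]_m) (f : 'rV[R]_m -> 'rV[R]_n) t :
  smooth_on W f -> W t -> {for t, continuous f}.
Proof. by move=> sf Wt; apply: differentiable_continuous; apply: (sf [::]). Qed.

Lemma locally_translates_diffeology T :
  is_diffeology (hull T) (locally_translates T).
Proof.
split; [by move=> p []|split; [|split]].
- move=> p [op hp] [c pc]; split=> // t0 pt0.
  exists (@pdom _ _ p), c, (fun=> 0); split=> //.
  + by rewrite -(pc _ pt0); apply: hp.
  + by apply/smooth_onP => k; apply: smooth_upto_cst.
  + by move=> t pt; rewrite pc // tr_tiling0.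
- move=> p pp H; split=> // t0 pt0; have [W [oW [Wt0 [Wp [_ HW]]]]] := H _ pt0.
  have [W' [T1 [f [[oW' W't0] W'W hT1 sf pE]]]] := HW _ Wt0.
  by exists W', T1, f; split=> //; apply: subset_trans W'W Wp.
move=> p m V f q [[op hp] H] oV sf fp qE; split.
  by split=> // t Vt; rewrite /= qE //; apply/hp/fp.
move=> /= t0 Vt0; have [W [T1 [g [[oW Wft0] Wp hT1 sg pE]]]] := H _ (fp _ Vt0).
have oVW : open (V `&` f @^-1` W).
  apply: (continuous_inP _ oV).1 oW => x; rewrite inE => Vx.
  exact: smooth_on_continuous sf Vx.
exists (V `&` f @^-1` W), T1, (fun t => g (f t)).
split; [by split|by move=> t []|by []| |by move=> t [Vt Wt]; rewrite qE // pE].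
apply: smooth_on_comp sg _ => //; first by move=> t [].
by apply: smooth_on_sub sf => t [].
Qed.

Lemma translation_family_sub T : translation_family T `<=` locally_translates T.
Proof.
move=> _ [T1 [hT1 ->]]; split; first by split=> [|t _]; [exact: openT|exact: hull_tr].
move=> t0 _ /=; exists setT, T1, id; split=> //; first by split=> //; exact: openT.
by apply/smooth_onP => k; apply: smooth_upto_id; apply: openT.
Qed.

Lemma locally_translates_sub_gen T :
  locally_translates T `<=` gen_diffeology (hull T) (translation_family T).
Proof.
move=> p [pp H] D [_ [_ [loc comp]]] FD; apply: loc => // t0 pt0.
have [W [T1 [f [[oW Wt0] Wp hT1 sf pE]]]] := H _ pt0.
exists W; split=> //; split=> //; split=> //.
apply: (comp (@Param R _ d setT (fun x => tr_tiling T1 x)) _ W f) => //.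
by apply: FD; exists T1.
Qed.

Hypothesis d_gt0 : (0 < d)%N.

Lemma locally_translates_sub_dr T : locally_translates T `<=` dr_diffeology T.
Proof.
move=> p [pp H]; split=> // t0 pt0.
have [W [T1 [f [[oW Wt0] Wp hT1 sf pE]]]] := H _ pt0.
have [e e0 rT] := is_tiling_rigid d_gt0 hT1.1.
have cf t : W t -> {for t, continuous f} by apply: smooth_on_continuous.
have e40 : 0 < e / 4 by lra.
(* Values of [f] within [e / 4] of [f t0] differ pairwise by less than [e / 2], the range of
   [dr_translate]. *)
have [del del0 Hdel] : exists2 del : R, 0 < del &
    eball t0 del `<=` W `&` f @^-1` eball (f t0) (e / 4).
  apply/nbhs_eballP; apply: filterI; first exact: open_nbhs_nbhs.
  apply: (cf t0 Wt0); apply: open_nbhs_nbhs; split; first exact: open_eball.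
  exact: eball_center.
have drE r t1 t : 0 < r -> eball t0 del t1 -> eball t0 del t ->
    dr r (@pmap _ _ p t1) (@pmap _ _ p t) = (enorm (f t - f t1))%:E.
  move=> r0 /Hdel [W1 f1] /Hdel [Wt ft]; rewrite !pE //.
  apply: (dr_translate rT); first exact: ltW.
  have -> : e / 2 = e / 4 + e / 4 by lra.
  by apply: enorm_lt_trans ft _; rewrite enormBC.
exists del => //; split; first by move=> t /Hdel [/Wp].
split=> [r r0|t1 t1del pt1 r r0].
  rewrite continuous_open_subspace; last exact: open_eball.
  move=> t; rewrite inE => tdel.
  have ballt : nbhs t (eball t0 del) by apply: open_nbhs_nbhs; split=> //; apply: open_eball.
  have c0 := eball_center t0 del0.
  rewrite /continuous_at drE //; apply: (cvg_EFin (F := nbhs t)).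
    by apply: filterS ballt => x xdel; rewrite drE.
  have cen : {for t, continuous (@enorm R d \o (fun x => f x - f t0))}.
    apply: continuous_comp; last exact: continuous_enorm.
    have ct : f x @[x --> t] --> f t := cf t (Hdel _ tdel).1.
    exact: (cvgB ct (cvg_cst _)).
  apply: cvg_trans cen; apply: near_eq_cvg.
  by apply: filterS ballt => x xdel; rewrite /= drE.
split=> [t tdel|]; first by rewrite drE.
have f10 : f t1 <> f t0.
  by move=> f10; apply: pt1; rewrite !pE ?f10 //; [case: (Hdel _ t1del)].
have [del2 del20 Hdel2] : exists2 del2 : R, 0 < del2 &
    eball t0 del2 `<=` eball t0 del `&` [set t | f t <> f t1].
  apply/nbhs_eballP; apply: filterI; first by apply/nbhs_eballP; exists del.
  have f10' : 0 < enorm (f t1 - f t0).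
    by rewrite lt_neqAle enorm_ge0 andbT eq_sym; apply/eqP => /enorm_eq0/subr0_eq.
  (* This ball just excludes [f t1], so near [t0] the norm of [f t - f t1] is smooth. *)
  have : nbhs (f t0) (eball (f t0) (enorm (f t1 - f t0))).
    by apply/nbhs_eballP; exists (enorm (f t1 - f t0)).
  move=> /(cf t0 Wt0) near_f.
  have {}near_f : nbhs t0 (f @^-1` eball (f t0) (enorm (f t1 - f t0))) by exact: near_f.
  apply: filterS near_f => t ft ftE.
  by move: ft; rewrite /eball /= ftE ltxx.
exists (eball t0 del2); split; first exact: open_eball.
split; first exact: eball_center.
split; first by move=> t /Hdel2 [].
apply: (@smooth_on_ext _ _ _ _ (fun t => enorm (f t - f t1) : R^o)).
- exact: open_eball.
- by move=> t /Hdel2 [tdel _]; rewrite drE.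
apply: smooth_on_enorm; first exact: open_eball.
  by move=> t /Hdel2 [].
by apply: smooth_on_sub sf => t /Hdel2 [/Hdel []].
Qed.

Lemma dr_sub_locally_translates T : dr_diffeology T `<=` locally_translates T.
Proof.
move=> p [pp H]; split=> // t0 pt0; have [del del0 [delp [cdr sdr]]] := H _ pt0.
have til t : eball t0 del t -> is_tiling (@pmap _ _ p t).
  by move=> /delp /(proj2 pp) [].
have [e e0 rT] := is_tiling_rigid d_gt0 (til _ (eball_center t0 del0)).
have [del1 del10 [sub1 H1]] := dr_continuous_orbit e0 rT del0 til cdr.
have /choice [u Hu] t : exists u, eball t0 del1 t -> enorm u < e / 4 /\
    @pmap _ _ p t = tr_tiling (@pmap _ _ p t0) u.
  have [/H1[u ue pE]|nt] := pselect (eball t0 del1 t); first by exists u.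
  by exists 0.
have uniq v w : enorm v < e / 4 -> enorm w < e / 4 ->
    tr_tiling (@pmap _ _ p t0) v = tr_tiling (@pmap _ _ p t0) w -> v = w.
  move=> ve we; apply: (rigid_tr_inj rT); apply: le_lt_trans (enormD _ _) _.
  by rewrite enormN; lra.
have e40 : 0 < e / 4 by lra.
have c0 := eball_center t0 del10.
have u0 : u t0 = 0.
  have [ue pE] := Hu _ c0; apply: uniq => //; first by rewrite enorm0.
  by rewrite -pE tr_tiling0.
have drE t1 t : eball t0 del1 t1 -> eball t0 del1 t ->
    dr 1 (@pmap _ _ p t1) (@pmap _ _ p t) = (enorm (u t - u t1))%:E.
  move=> /Hu [u1 ->] /Hu [ut ->]; apply: (dr_translate rT) => //.
  apply: le_lt_trans (enormD _ _) _; rewrite enormN; lra.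
have [|||W [oW Wt0] [W1 su]] := @smooth_of_smooth_distances _ _ _ u (eball t0 del1) t0.
- by apply/nbhs_eballP; exists del1.
- move=> x x0; have cdr1 : {for t0, continuous (fun t => dr 1 (@pmap _ _ p t0) (@pmap _ _ p t))}.
    have := cdr 1 ltr01; rewrite continuous_open_subspace; last exact: open_eball.
    by apply; rewrite inE; apply: eball_center.
  have : nbhs (dr 1 (@pmap _ _ p t0) (@pmap _ _ p t0)) [set y | (y < x%:E)%E].
    apply: open_nbhs_nbhs; split; first exact: open_ereal_lt_ereal.
    by rewrite /= drE // subrr enorm0 lte_fin.
  move=> /cdr1 ndrx.
  have {}ndrx : nbhs t0 [set t | (dr 1 (@pmap _ _ p t0) (@pmap _ _ p t) < x%:E)%E] by exact: ndrx.
  have balld : nbhs t0 (eball t0 del1) by apply/nbhs_eballP; exists del1.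
  apply: filterS2 ndrx balld => t drx tdel; apply: le_lt_trans (norm_le_enorm _) _.
  by move: drx; rewrite /= drE // u0 subr0 lte_fin.
- move=> t1 t1del ut1.
  (* Rigidity turns [u t1 <> 0] into [p t1 <> p t0], the case in which condition (2) supplies
     smoothness. *)
  have pt1 : @pmap _ _ p t1 <> @pmap _ _ p t0.
    have [ue ->] := Hu _ t1del; rewrite -[RHS]tr_tiling0 => /uniq; rewrite enorm0.
    by move=> /(_ ue e40).
  have [_ [W [oW [Wt0 [_ sW]]]]] := sdr t1 (sub1 _ t1del) pt1 1 ltr01.
  exists (W `&` eball t0 del1); split; [|by []|].
    by apply: openI oW _; apply: open_eball.
  apply: (@smooth_on_ext _ _ _ _
    (fun t => fine (dr 1 (@pmap _ _ p t1) (@pmap _ _ p t)) : R^o)).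
  + by apply: openI oW _; apply: open_eball.
  + by move=> t [_ tdel]; rewrite drE.
  by apply: smooth_on_sub sW => t [].
exists W, (@pmap _ _ p t0), u; split=> //.
- by move=> t /W1 /sub1 /delp.
- by case: pp => _; apply.
- by move=> t /W1 /Hu [].
Qed.

End Diffeologies.

Theorem theorem5p8 (R : realType) (d : nat) (hd : (0 < d)%N)
  (T : set (set 'rV[R]_d)) (hT : is_tiling T) :
  gen_diffeology (hull T) (translation_family T) = dr_diffeology T.
Proof.
apply/seteqP; split=> p.
  move=> /(_ _ (locally_translates_diffeology T) (@translation_family_sub _ _ T)).
  exact: locally_translates_sub_dr.
move=> /(dr_sub_locally_translates hd); exact: locally_translates_sub_gen.
Qed.
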